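(* Let $k$ be a field, $R$ a $k$-algebra, ${}_R\mathrm{Mod}$ the category of left $R$-modules, $Q$ the repetitive quiver $\mathbb{Z}A_3$ modulo the mesh relations, and $\mathscr{X}$ the category of representations of $Q$ with values in ${}_R\mathrm{Mod}$. If $(\mathscr{A},\mathscr{B})$ is a hereditary cotorsion pair in ${}_R\mathrm{Mod}$, then there are hereditary, compatible cotorsion pairs $\big(\Phi(\mathscr{A}),\Phi(\mathscr{A})^{\perp}\big)$ and $\big({}^{\perp}\Psi(\mathscr{B}),\Psi(\mathscr{B})\big)$ in $\mathscr{X}$, where: $\Phi(\mathscr{A})$ is the class of $X\in\mathscr{X}$ such that for each $j\in\mathbb{Z}$ each of the cokernels $$\operatorname{Coker}(X_{(j,1)}\to X_{(j-1,0)}),\quad \operatorname{Coker}(X_{(j,0)}\oplus X_{(j+1,2)}\to X_{(j,1)}),\quad \operatorname{Coker}(X_{(j,1)}\to X_{(j,2)})$$ is in $\mathscr{A}$, and each of the short chain complexes $$X_{(j,0)}\to X_{(j,1)}\to X_{(j-1,0)},\quad X_{(j,1)}\to X_{(j-1,0)}\oplus X_{(j,2)}\to X_{(j-1,1)},\quad X_{(j,2)}\to X_{(j-1,1)}\to X_{(j-1,2)}\qquad(\ast)$$ is exact (at the middle term); $\Psi(\mathscr{B})$ is the class of $X\in\mathscr{X}$ such that for each $j\in\mathbb{Z}$ each of the kernels $$\operatorname{Ker}(X_{(j,0)}\to X_{(j,1)}),\quad \operatorname{Ker}(X_{(j,1)}\to X_{(j-1,0)}\oplus X_{(j,2)}),\quad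 \operatorname{Ker}(X_{(j,2)}\to X_{(j-1,1)})$$ is in $\mathscr{B}$, and each of the short chain complexes $(\ast)$ is exact (at the middle term).
   Context: The quiver $Q$: the vertices are $(j,\ell)$ with $j\in\mathbb{Z}$, $\ell\in\{0,1,2\}$, and for each $j\in\mathbb{Z}$ there are arrows $(j,0)\to(j,1)$, $(j,1)\to(j,2)$, $(j,1)\to(j-1,0)$, $(j,2)\to(j-1,1)$. The mesh relations are: for each $j$ the compositions $(j,0)\to(j,1)\to(j-1,0)$ and $(j,2)\to(j-1,1)\to(j-1,2)$ are zero, and each square formed by $(j,1)\to(j-1,0)\to(j-1,1)$ and $(j,1)\to(j,2)\to(j-1,1)$ is anticommutative (the two compositions sum to zero). A representation $X$ assigns to each vertex $(j,\ell)$ a left $R$-module $X_{(j,\ell)}$ and to each arrow an $R$-homomorphism so that the relations hold. All maps in the claim are the ones with components given by these arrows; by the mesh relations the sequences $(\ast)$ are indeed chain complexes. Cotorsion pairs. Let $\mathscr{Y}$ be an abelian category. For classes of objects $\Gamma,\Delta$ put $\Gamma^{\perp}=\{Y\mid \operatorname{Ext}^1_{\mathscr{Y}}(C,Y)=0 \text{ for all } C\in\Gamma\}$ and ${}^{\perp}\Delta=\{Y\mid \operatorname{Ext}^1_{\mathscr{Y}}(Y,D)=0 \text{ for all } D\in\Delta\}$. A cotorsion pair is a pair $(\Gamma,\Delta)$ with $\Gamma={}^{\perp}\Delta$ and $\Gamma^{\perp}=\Delta$. It is hereditary if $\Gamma$ is closed under kernels of epimorphisms and $\Delta$ is closed under cokernels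 of monomorphisms. Cotorsion pairs $(\Phi,\Phi^{\perp})$ and $({}^{\perp}\Psi,\Psi)$ (in this order) are compatible if $\operatorname{Ext}^1_{\mathscr{Y}}(F,P)=0$ for all $F\in\Phi$, $P\in\Psi$, and $\Phi\cap\Phi^{\perp}={}^{\perp}\Psi\cap\Psi$. *)

(* Defs.v *)
From HB Require Import structures.
From mathcomp Require Import all_boot all_order all_algebra all_classical.
Import GRing.Theory.
Local Open Scope ring_scope.
Local Open Scope classical_set_scope.

Set Implicit Arguments.
Unset Strict Implicit.
Unset Printing Implicit Defensive.

Record pointedCategory := PointedCategory {
  obj :> Type;
  mor : obj -> obj -> Type;
  idm : forall X, mor X X;
  mcomp : forall X Y Z, mor Y Z -> mor X Y -> mor X Z;
  zerom : forall X Y, mor X Y;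
  mcompA : forall W X Y Z (h : mor Y Z) (g : mor X Y) (f : mor W X),
    mcomp h (mcomp g f) = mcomp (mcomp h g) f;
  mcomp1m : forall X Y (f : mor X Y), mcomp (idm Y) f = f;
  mcompm1 : forall X Y (f : mor X Y), mcomp f (idm X) = f;
  mcomp0m : forall X Y Z (f : mor X Y), mcomp (zerom Y Z) f = zerom X Z;
  mcompm0 : forall X Y Z (f : mor Y Z), mcomp f (zerom X Y) = zerom X Z
}.

Arguments mor {_} _ _.
Arguments idm {_} X.
Arguments mcomp {_ X Y Z} _ _.
Arguments zerom {_} X Y.

Notation "g \oc f" := (mcomp g f) (at level 50, left associativity).

Section UniversalProperties.
Variable C : pointedCategory.

Definition is_mono (X Y : C) (f : mor X Y) :=
  forall (W : C) (g h : mor W X), f \oc g = f \oc h -> g = h.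

Definition is_epi (X Y : C) (f : mor X Y) :=
  forall (Z : C) (g h : mor Y Z), g \oc f = h \oc f -> g = h.

Definition is_kernel (K X Y : C) (f : mor X Y) (i : mor K X) :=
  f \oc i = zerom K Y /\
  forall (W : C) (g : mor W X), f \oc g = zerom W Y ->
    exists! h : mor W K, i \oc h = g.

Definition is_cokernel (X Y Q : C) (f : mor X Y) (p : mor Y Q) :=
  p \oc f = zerom X Q /\
  forall (Z : C) (g : mor Y Z), g \oc f = zerom X Z ->
    exists! h : mor Q Z, h \oc p = g.

Definition is_biproduct (X Y S : C) (i1 : mor X S) (i2 : mor Y S)
    (p1 : mor S X) (p2 : mor S Y) :=
  [/\ [/\ p1 \oc i1 = idm X, p2 \oc i2 = idm Y,
          p1 \oc i2 = zerom Y X & p2 \oc i1 = zerom X Y],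
      (forall (W : C) (f : mor W X) (g : mor W Y),
         exists! h : mor W S, p1 \oc h = f /\ p2 \oc h = g) &
      (forall (Z : C) (f : mor X Z) (g : mor Y Z),
         exists! h : mor S Z, h \oc i1 = f /\ h \oc i2 = g)].

Definition short_exact (X Y Z : C) (f : mor X Y) (g : mor Y Z) :=
  is_kernel g f /\ is_cokernel f g.

End UniversalProperties.

(* The addition of morphisms is not part of the structure: it is determined
   by the biproducts, and its properties follow from the axioms below. *)
Record abelianCategory := AbelianCategory {
  pcat :> pointedCategory;
  zero_objectP : exists Z : pcat, forall X : pcat,
    (forall f : mor X Z, f = zerom X Z) /\ (forall f : mor Z X, f = zerom Z X);
  dsum : pcat -> pcat -> pcat;
  binl : forall X Y, mor X (dsum X Y);
  binr : forall X Y, mor Y (dsum X Y);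
  bprl : forall X Y, mor (dsum X Y) X;
  bprr : forall X Y, mor (dsum X Y) Y;
  dsumP : forall X Y, is_biproduct (binl X Y) (binr X Y) (bprl X Y) (bprr X Y);
  has_kernels : forall (X Y : pcat) (f : mor X Y),
    exists (K : pcat) (i : mor K X), is_kernel f i;
  has_cokernels : forall (X Y : pcat) (f : mor X Y),
    exists (Q : pcat) (p : mor Y Q), is_cokernel f p;
  mono_normal : forall (X Y : pcat) (f : mor X Y), is_mono f ->
    exists (Z : pcat) (g : mor Y Z), is_kernel g f;
  epi_normal : forall (X Y : pcat) (f : mor X Y), is_epi f ->
    exists (Z : pcat) (g : mor Z X), is_cokernel g f
}.

Arguments binl {_} X Y.
Arguments binr {_} X Y.
Arguments bprl {_} X Y.
Arguments bprr {_} X Y.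

Section Cotorsion.
Variable C : abelianCategory.
Implicit Types X Y : C.

(* an extension 0 -> Y -> E -> X -> 0 of X by Y *)
Record extension X Y := Extension {
  ext_obj : C;
  ext_inj : mor Y ext_obj;
  ext_proj : mor ext_obj X;
  ext_exact : short_exact ext_inj ext_proj
}.

Definition ext_equiv X Y (E E' : extension X Y) :=
  exists phi : mor (ext_obj E) (ext_obj E'),
    phi \oc ext_inj E = ext_inj E' /\ ext_proj E' \oc phi = ext_proj E.

Lemma split_exact X Y : short_exact (binl Y X) (bprr Y X).
Proof.
have [[e1 e2 e3 e4] prodP coprodP] := dsumP Y X.
split; split=> //.
  move=> W g g0; exists (bprl Y X \oc g).
  split=> [|h <-]; last by rewrite mcompA e1 mcomp1m.
  have [u [_ uu]] := prodP W (bprl Y X \oc g) (bprr Y X \oc g).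
  rewrite -[RHS]uu //; apply/esym/uu.
  by rewrite !mcompA e1 e4 mcomp1m !mcomp0m g0.
move=> Z g g0; exists (g \oc binr Y X).
split=> [|h <-]; last by rewrite -mcompA e2 mcompm1.
have [u [_ uu]] := coprodP Z (g \oc binl Y X) (g \oc binr Y X).
rewrite -[RHS]uu //; apply/esym/uu.
by rewrite -!mcompA e2 e4 mcompm1 !mcompm0 g0.
Qed.

Definition split_extension X Y : extension X Y := Extension (split_exact X Y).

(* Ext^1(X, Y) = 0, where Ext^1(X, Y) is Yoneda's group of equivalence classes
   of extensions, whose zero is the class of the split extension *)
Definition Ext1_zero X Y :=
  forall E : extension X Y, ext_equiv (split_extension X Y) E.

(* Classes of objects are plain predicates: the category of R-modules is too
   large for the universe of the type `set` of classical_sets. *)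
Definition rperp (Gamma : C -> Prop) (Y : C) :=
  forall X, Gamma X -> Ext1_zero X Y.

Definition lperp (Delta : C -> Prop) (X : C) :=
  forall Y, Delta Y -> Ext1_zero X Y.

Definition cotorsion_pair (Gamma Delta : C -> Prop) :=
  (forall X, Gamma X <-> lperp Delta X) /\
  (forall Y, rperp Gamma Y <-> Delta Y).

(* Kernels are only defined up to isomorphism, so the closure conditions range
   over all kernels (resp. cokernels) of a given morphism. *)
Definition closed_ker_epi (Gamma : C -> Prop) :=
  forall (K X Y : C) (f : mor X Y) (i : mor K X),
    is_epi f -> is_kernel f i -> Gamma X -> Gamma Y -> Gamma K.

Definition closed_coker_mono (Delta : C -> Prop) :=
  forall (X Y Q : C) (f : mor X Y) (p : mor Y Q),
    is_mono f -> is_cokernel f p -> Delta X -> Delta Y -> Delta Q.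

Definition hereditary_cotorsion_pair (Gamma Delta : C -> Prop) :=
  [/\ cotorsion_pair Gamma Delta, closed_ker_epi Gamma &
      closed_coker_mono Delta].

(* compatibility of the pairs (Phi, Phi') and (Psi', Psi), in this order *)
Definition compatible (Phi Phi' Psi' Psi : C -> Prop) :=
  (forall F P : C, Phi F -> Psi P -> Ext1_zero F P) /\
  (forall X : C, Phi X /\ Phi' X <-> Psi' X /\ Psi X).

End Cotorsion.

Section Modules.
Variable R : pzRingType.
Implicit Types U V W : lmodType R.

Lemma lin_ext U V (f g : {linear U -> V}) : f =1 g -> f = g.
Proof.
case: f g => [f [[a] [b]]] [g [[a'] [b']]] /= /funext fg.
by subst g; rewrite (Prop_irrelevance a a') (Prop_irrelevance b b').
Qed.

Lemma lin_eq U V (f g : {linear U -> V}) : f = g -> f =1 g.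
Proof. by move=> ->. Qed.

Definition in_ker U V (f : {linear U -> V}) : {pred U} := fun x => f x == 0.

Fact in_ker_closed U V (f : {linear U -> V}) : submod_closed (in_ker f).
Proof.
split=> [|a x y]; first by rewrite unfold_in /in_ker linear0.
rewrite !unfold_in /in_ker => /eqP fx /eqP fy.
by rewrite linearP fx fy scaler0 addr0.
Qed.

HB.instance Definition _ U V (f : {linear U -> V}) :=
  GRing.isSubmodClosed.Build R U (in_ker f) (in_ker_closed f).

Definition ker_type U V (f : {linear U -> V}) := {x : U | x \in in_ker f}.

HB.instance Definition _ U V (f : {linear U -> V}) :=
  SubChoice.on (ker_type f).
HB.instance Definition _ U V (f : {linear U -> V}) :=
  [SubChoice_isSubLmodule of ker_type f by <:].

Definition Ker U V (f : {linear U -> V}) : lmodType R := ker_type f.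

Definition in_range U V (f : {linear U -> V}) : {pred V} :=
  fun y => `[< range f y >].

Fact in_range_closed U V (f : {linear U -> V}) : submod_closed (in_range f).
Proof.
split=> [|a x y]; first by apply/asboolP; exists 0 => //; rewrite linear0.
move=> /asboolP[u _ <-] /asboolP[v _ <-].
by apply/asboolP; exists (a *: u + v) => //; rewrite linearP.
Qed.

HB.instance Definition _ U V (f : {linear U -> V}) :=
  GRing.isSubmodClosed.Build R V (in_range f) (in_range_closed f).

Definition coker_type U V (f : {linear U -> V}) :=
  Quotient.quot (in_range f : zmodClosed V).

HB.instance Definition _ U V (f : {linear U -> V}) :=
  GRing.Zmodule.on (coker_type f).

Section CokernelModule.
Variables (U V : lmodType R) (f : {linear U -> V}).
Local Notation Q := (coker_type f).
Local Open Scope quotient_scope.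

Definition coker_pi (x : V) : Q := \pi_(Q) x.

Lemma coker_piE x y : coker_pi x = coker_pi y <-> range f (x - y).
Proof.
have e : (x - y \in in_range f) = (coker_pi x == coker_pi y).
  exact: (Quotient.idealrBE (in_range f : zmodClosed V) x y).
split=> [/eqP|r]; first by rewrite -e => /asboolP r; exact: r.
by apply/eqP; rewrite -e; apply/asboolP; exact: r.
Qed.

Lemma coker_piK q : coker_pi (repr q) = q. Proof. exact: reprK. Qed.

Let piD x y : coker_pi (x + y) = coker_pi x + coker_pi y.
Proof. exact: (Quotient.pi_add (in_range f : zmodClosed V)). Qed.

Definition coker_scale (a : R) (q : Q) : Q := coker_pi (a *: repr q).

Lemma coker_scale_pi a x : coker_scale a (coker_pi x) = coker_pi (a *: x).
Proof.
apply/coker_piE; rewrite -scalerBr.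
have /coker_piE[u _ uE] : coker_pi (repr (coker_pi x)) = coker_pi x by rewrite coker_piK.
by exists (a *: u) => //; rewrite linearZ uE.
Qed.

Fact coker_scaleA a b q :
  coker_scale a (coker_scale b q) = coker_scale (a * b) q.
Proof. by rewrite -[q]coker_piK !coker_scale_pi scalerA. Qed.

Fact coker_scale1 : left_id 1 coker_scale.
Proof. by move=> q; rewrite -[q]coker_piK coker_scale_pi scale1r. Qed.

Fact coker_scaleDr : right_distributive coker_scale +%R.
Proof.
move=> a p q; rewrite -[p]coker_piK -[q]coker_piK.
by rewrite -piD !coker_scale_pi scalerDr piD.
Qed.

Fact coker_scaleDl q : {morph coker_scale^~ q : a b / a + b}.
Proof.
by move=> a b; rewrite -[q]coker_piK !coker_scale_pi scalerDl piD.
Qed.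

HB.instance Definition _ := GRing.Zmodule_isLmodule.Build R Q
  coker_scaleA coker_scale1 coker_scaleDr coker_scaleDl.

Definition Coker : lmodType R := Q.

Fact coker_pi_linear : linear (coker_pi : V -> Coker).
Proof. by move=> a x y; rewrite piD -coker_scale_pi. Qed.

HB.instance Definition _ :=
  GRing.isLinear.Build R V Coker *:%R coker_pi coker_pi_linear.

Definition coker_proj : {linear V -> Coker} := coker_pi.

Lemma coker_proj_surj (q : Coker) : exists x, coker_proj x = q.
Proof. by exists (repr q); apply: coker_piK. Qed.

Lemma coker_proj_eq0 x : coker_proj x = 0 <-> range f x.
Proof.
rewrite -[x in range f x]subr0 -coker_piE -/(coker_proj 0) linear0.
by [].
Qed.

End CokernelModule.

Definition ker_incl U V (f : {linear U -> V}) : {linear Ker f -> U} :=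
  (val : Ker f -> U).

Lemma ker_incl_inj U V (f : {linear U -> V}) : injective (ker_incl f).
Proof. exact: val_inj. Qed.

Lemma ker_inclP U V (f : {linear U -> V}) x :
  f x = 0 <-> range (ker_incl f) x.
Proof.
split=> [fx|[k _ <-]]; last by apply/eqP; apply: (valP k).
have xk : x \in in_ker f by apply/eqP.
by exists (Sub x xk : ker_type f) => //; apply: SubK.
Qed.

Section Pairing.
Variables (U V W : lmodType R).

Definition pair_fun (f : {linear W -> U}) (g : {linear W -> V}) (w : W) :
  (U * V)%type := (f w, g w).

Fact pair_fun_linear f g : linear (pair_fun f g).
Proof. by move=> a x y; rewrite /pair_fun !linearP. Qed.

HB.instance Definition _ f g :=
  GRing.isLinear.Build R W (U * V)%type *:%R (pair_fun f g)
    (pair_fun_linear f g).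

Definition pair_lin f g : {linear W -> (U * V)%type} := pair_fun f g.

Definition copair_fun (f : {linear U -> W}) (g : {linear V -> W})
  (x : (U * V)%type) : W := f x.1 + g x.2.

Fact copair_fun_linear f g : linear (copair_fun f g).
Proof.
by move=> a x y; rewrite /copair_fun /= !linearP /= scalerDr addrACA.
Qed.

HB.instance Definition _ f g :=
  GRing.isLinear.Build R (U * V)%type W *:%R (copair_fun f g)
    (copair_fun_linear f g).

Definition copair_lin f g : {linear (U * V)%type -> W} := copair_fun f g.

End Pairing.

Section Factor.
Variables (U V W : lmodType R).

Section Lift.
Variables (m : {linear U -> V}) (g : {linear W -> V}).
Hypotheses (m_inj : injective m) (g_im : forall w, exists u, m u = g w).

Definition lift_fun (w : W) : U := projT1 (cid (g_im w)).

Fact lift_funE w : m (lift_fun w) = g w.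
Proof. exact: (projT2 (cid (g_im w))). Qed.

Fact lift_fun_linear : linear lift_fun.
Proof. by move=> a x y; apply: m_inj; rewrite linearP !lift_funE linearP. Qed.

HB.instance Definition _ :=
  GRing.isLinear.Build R W U *:%R lift_fun lift_fun_linear.

Definition lin_lift : {linear W -> U} := lift_fun.

Lemma lin_liftE w : m (lin_lift w) = g w.
Proof. exact: lift_funE. Qed.
End Lift.

Section Desc.
Variables (p : {linear V -> U}) (g : {linear V -> W}).
Hypotheses (p_surj : forall u, exists v, p v = u)
  (g_ker : forall v, p v = 0 -> g v = 0).

Definition desc_fun (u : U) : W := g (projT1 (cid (p_surj u))).

Fact desc_funE v : desc_fun (p v) = g v.
Proof.
apply/eqP; rewrite -subr_eq0 -linearB; apply/eqP/g_ker.
by rewrite linearB (projT2 (cid (p_surj (p v)))) subrr.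
Qed.

Fact desc_fun_linear : linear desc_fun.
Proof.
move=> a x y; have [x' <-] := p_surj x; have [y' <-] := p_surj y.
by rewrite -linearP !desc_funE linearP.
Qed.

HB.instance Definition _ :=
  GRing.isLinear.Build R U W *:%R desc_fun desc_fun_linear.

Definition lin_desc : {linear U -> W} := desc_fun.

Lemma lin_descE v : lin_desc (p v) = g v.
Proof. exact: desc_funE. Qed.
End Desc.

End Factor.

Definition modPointed : pointedCategory.
Proof.
refine (@PointedCategory (lmodType R) (fun U V => {linear U -> V})
  (fun U => idfun) (fun U V W g f => g \o f) (fun U V => \0) _ _ _ _ _).
- by move=> *; apply: lin_ext.
- by move=> *; apply: lin_ext.
- by move=> *; apply: lin_ext.
- by move=> *; apply: lin_ext.
- by move=> U V W f; apply: lin_ext => x /=; rewrite linear0.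
Defined.

Local Notation M := modPointed.

Lemma mod_is_kernel U V W (f : {linear V -> W}) (i : {linear U -> V}) :
  injective i -> (forall x, f x = 0 <-> range i x) ->
  @is_kernel M U V W f i.
Proof.
move=> i_inj iP; split.
  by apply: lin_ext => u /=; apply/iP; exists u.
move=> T g g0.
have g_im t : exists u, i u = g t.
  have /iP[u _ <-] : f (g t) = 0 by exact: (lin_eq g0 t).
  by exists u.
exists (lin_lift i_inj g_im); split.
  by apply: lin_ext => t; apply: lin_liftE.
by move=> h h_g; apply: lin_ext => t; apply: (i_inj); rewrite lin_liftE -h_g.
Qed.

Lemma mod_is_cokernel U V W (f : {linear U -> V}) (p : {linear V -> W}) :
  (forall w, exists x, p x = w) -> (forall x, p x = 0 <-> range f x) ->
  @is_cokernel M U V W f p.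
Proof.
move=> p_surj pP; split.
  by apply: lin_ext => u /=; apply/pP; exists u.
move=> T g g0.
have g_ker v : p v = 0 -> g v = 0.
  by move=> /pP[u _ <-]; exact: (lin_eq g0 u).
exists (lin_desc p_surj g_ker); split.
  by apply: lin_ext => v; apply: lin_descE.
move=> h h_g; apply: lin_ext => w; have [v <-] := p_surj w.
by rewrite lin_descE -h_g.
Qed.

Lemma mod_monoP U V (f : {linear U -> V}) : @is_mono M U V f -> injective f.
Proof.
move=> f_mono x y fxy.
have fi : @mcomp M _ _ _ f (ker_incl f) = @mcomp M _ _ _ f (@zerom M _ _).
  apply: lin_ext => k /=; rewrite linear0; apply/ker_inclP.
  by exists k.
have /ker_inclP[k _ kE] : f (x - y) = 0 by rewrite linearB fxy subrr.
apply/eqP; rewrite -subr_eq0 -kE; apply/eqP.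
exact: (lin_eq (f_mono _ _ _ fi) k).
Qed.

Lemma mod_epiP U V (f : {linear U -> V}) :
  @is_epi M U V f -> forall y, exists x, f x = y.
Proof.
move=> f_epi y.
have fp : @mcomp M _ _ _ (coker_proj f) f = @mcomp M _ _ _ (@zerom M _ _) f.
  by apply: lin_ext => x /=; apply/coker_proj_eq0; exists x.
have /coker_proj_eq0[x _ xE] : coker_proj f y = 0.
  exact: (lin_eq (f_epi _ _ _ fp) y).
by exists x.
Qed.

Definition modCat : abelianCategory.
Proof.
refine (@AbelianCategory M _ (fun U V => (U * V)%type)
  (fun U V => pair_lin idfun \0) (fun U V => pair_lin \0 idfun)
  (fun U V => copair_lin idfun \0) (fun U V => copair_lin \0 idfun)
  _ _ _ _ _).
- exists ('rV[R]_0 : lmodType R) => U; split=> f; apply: lin_ext => x.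
    by apply/rowP => -[].
  by rewrite /= (_ : x = 0) ?linear0 //; apply/rowP => -[].
- move=> U V; split.
  + by split; apply: lin_ext => x /=; rewrite /copair_fun /= ?addr0 ?add0r.
  + move=> W f g; exists (pair_lin f g); split.
      by split; apply: lin_ext => x; rewrite /= /copair_fun /= ?addr0 ?add0r.
    move=> h [<- <-]; apply: lin_ext => x /=.
    by rewrite /pair_fun /= /copair_fun /= addr0 add0r; case: (h x).
  + move=> W f g; exists (copair_lin f g); split.
      split; apply: lin_ext => x; rewrite /= /copair_fun /=.
        by rewrite linear0 addr0.
      by rewrite linear0 add0r.
    move=> h [<- <-]; apply: lin_ext => -[x y] /=.
    rewrite /copair_fun /= -linearD; congr (h _).
    by congr pair; rewrite /= ?addr0 ?add0r.
- move=> U V f; exists (Ker f), (ker_incl f).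
  by apply: mod_is_kernel; [apply: ker_incl_inj | apply: ker_inclP].
- move=> U V f; exists (Coker f), (coker_proj f).
  by apply: mod_is_cokernel; [apply: coker_proj_surj | apply: coker_proj_eq0].
- move=> U V f /mod_monoP f_inj; exists (Coker f), (coker_proj f).
  by apply: mod_is_kernel => // x; apply: coker_proj_eq0.
- move=> U V f /mod_epiP f_surj; exists (Ker f), (ker_incl f).
  by apply: mod_is_cokernel => // x; apply: ker_inclP.
Defined.

End Modules.

(* The vertex (j, l) is written (j, Ll); the constructor aml j is the arrow
   from the vertex (j, m) to level l. *)
Variant level := L0 | L1 | L2.

Definition vertex : Type := int * level.

Inductive zarrow : vertex -> vertex -> Type :=
| a01 (j : int) : zarrow (j, L0) (j, L1)
| a12 (j : int) : zarrow (j, L1) (j, L2)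
| a10 (j : int) : zarrow (j, L1) (j - 1, L0)
| a21 (j : int) : zarrow (j, L2) (j - 1, L1).

Section Representations.
Variable R : pzRingType.

Record zrep := ZRep {
  rep_obj :> vertex -> lmodType R;
  rep_map : forall u v, zarrow u v -> {linear rep_obj u -> rep_obj v};
  rep_mesh0 : forall j (x : rep_obj (j, L0)),
    rep_map (a10 j) (rep_map (a01 j) x) = 0;
  rep_mesh1 : forall j (x : rep_obj (j, L1)),
    rep_map (a01 (j - 1)) (rep_map (a10 j) x)
      + rep_map (a21 j) (rep_map (a12 j) x) = 0;
  rep_mesh2 : forall j (x : rep_obj (j, L2)),
    rep_map (a12 (j - 1)) (rep_map (a21 j) x) = 0
}.

Arguments rep_map X {u v} _ : rename.

Record zrep_mor (X Y : zrep) := ZRepMor {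
  rep_fun :> forall v : vertex, {linear X v -> Y v};
  rep_nat : forall u v (a : zarrow u v) (x : X u),
    rep_fun v (rep_map X a x) = rep_map Y a (rep_fun u x)
}.

Implicit Types X Y Z : zrep.

Lemma rep_ext X Y (f g : zrep_mor X Y) : (forall v, f v =1 g v) -> f = g.
Proof.
case: f g => [f fN] [g gN] /= fg.
have E : f = g by apply: functional_extensionality_dep => v; apply/lin_ext/fg.
by subst g; rewrite (Prop_irrelevance fN gN).
Qed.

Lemma rep_eq X Y (f g : zrep_mor X Y) : f = g -> forall v, f v =1 g v.
Proof. by move=> ->. Qed.

Definition rep_id X : zrep_mor X X.
Proof. by exists (fun v => idfun). Defined.

Definition rep_comp X Y Z (g : zrep_mor Y Z) (f : zrep_mor X Y) :
  zrep_mor X Z.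
Proof. by exists (fun v => g v \o f v) => u v a x /=; rewrite !rep_nat. Defined.

Definition rep_zero X Y : zrep_mor X Y.
Proof. by exists (fun v => \0) => u v a x /=; rewrite linear0. Defined.

Definition repPointed : pointedCategory.
Proof.
refine (@PointedCategory zrep zrep_mor rep_id rep_comp rep_zero _ _ _ _ _).
- by move=> *; apply: rep_ext.
- by move=> *; apply: rep_ext.
- by move=> *; apply: rep_ext.
- by move=> *; apply: rep_ext.
- by move=> X Y Z f; apply: rep_ext => v x /=; rewrite linear0.
Defined.

Local Notation P := repPointed.

Section Subrep.
Variables (X : zrep) (K : vertex -> lmodType R)
  (m : forall v, {linear K v -> X v}).
Hypotheses (m_inj : forall v, injective (m v))
  (m_stable : forall u v (a : zarrow u v) (k : K u),
     exists k', m v k' = (rep_map X a \o m u) k).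

Definition subrep_map u v (a : zarrow u v) : {linear K u -> K v} :=
  lin_lift (@m_inj v) (m_stable a).

Lemma subrep_mapE u v (a : zarrow u v) k :
  m v (subrep_map a k) = rep_map X a (m u k).
Proof. exact: lin_liftE. Qed.

Definition subrep : zrep.
Proof.
exists K subrep_map => j x; apply: m_inj.
- by rewrite !subrep_mapE rep_mesh0 linear0.
- by rewrite linearD /= !subrep_mapE rep_mesh1 linear0.
- by rewrite !subrep_mapE rep_mesh2 linear0.
Defined.

Definition subrep_incl : zrep_mor subrep X.
Proof. by exists m => u v a x; rewrite -subrep_mapE. Defined.
End Subrep.

Section Quotrep.
Variables (X : zrep) (Q : vertex -> lmodType R)
  (p : forall v, {linear X v -> Q v}).
Hypotheses (p_surj : forall v q, exists x, p v x = q)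
  (p_stable : forall u v (a : zarrow u v) (x : X u),
     p u x = 0 -> (p v \o rep_map X a) x = 0).

Definition quotrep_map u v (a : zarrow u v) : {linear Q u -> Q v} :=
  lin_desc (@p_surj u) (p_stable a).

Lemma quotrep_mapE u v (a : zarrow u v) x :
  quotrep_map a (p u x) = p v (rep_map X a x).
Proof. exact: lin_descE. Qed.

Definition quotrep : zrep.
Proof.
exists Q quotrep_map => j q; have [x <-] := p_surj q.
- by rewrite !quotrep_mapE rep_mesh0 linear0.
- by rewrite !quotrep_mapE -linearD rep_mesh1 linear0.
- by rewrite !quotrep_mapE rep_mesh2 linear0.
Defined.

Definition quotrep_proj : zrep_mor X quotrep.
Proof. by exists p => u v a x; rewrite -quotrep_mapE. Defined.
End Quotrep.

Lemma rep_is_kernel X Y Z (f : zrep_mor Y Z) (i : zrep_mor X Y) :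
  (forall v, injective (i v)) ->
  (forall v x, f v x = 0 <-> range (i v) x) -> @is_kernel P X Y Z f i.
Proof.
move=> i_inj iP; split.
  by apply: rep_ext => v u /=; apply/iP; exists u.
move=> T g g0.
have g_im v t : exists u, i v u = g v t.
  have /iP[u _ <-] : f v (g v t) = 0 by exact: (rep_eq g0 t).
  by exists u.
pose h v := lin_lift (@i_inj v) (g_im v).
have hE v t : i v (h v t) = g v t by apply: lin_liftE.
have hN u v (a : zarrow u v) t : h v (rep_map T a t) = rep_map X a (h u t).
  by apply: (i_inj); rewrite hE !rep_nat hE.
exists (ZRepMor hN); split; first by apply: rep_ext => v t; apply: hE.
move=> h' h'g; apply: rep_ext => v t; apply: (i_inj).
by rewrite [LHS]hE -h'g.
Qed.

Lemma rep_is_cokernel X Y Z (f : zrep_mor X Y) (p : zrep_mor Y Z) :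
  (forall v z, exists y, p v y = z) ->
  (forall v y, p v y = 0 <-> range (f v) y) -> @is_cokernel P X Y Z f p.
Proof.
move=> p_surj pP; split.
  by apply: rep_ext => v u /=; apply/pP; exists u.
move=> T g g0.
have g_ker v y : p v y = 0 -> g v y = 0.
  by move=> /pP[u _ <-]; exact: (rep_eq g0 u).
pose h v := lin_desc (@p_surj v) (g_ker v).
have hE v y : h v (p v y) = g v y by apply: lin_descE.
have hN u v (a : zarrow u v) t : h v (rep_map Z a t) = rep_map T a (h u t).
  by have [y <-] := p_surj u t; rewrite hE -!rep_nat hE.
exists (ZRepMor hN); split; first by apply: rep_ext => v t; apply: hE.
move=> h' h'g; apply: rep_ext => v z; have [y <-] := p_surj v z.
by rewrite [LHS]hE -h'g.
Qed.

Section KernelCokernel.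
Variables (X Y : zrep) (f : zrep_mor X Y).

Fact kerrep_stable u v (a : zarrow u v) (k : Ker (f u)) :
  exists k', ker_incl (f v) k' = (rep_map X a \o ker_incl (f u)) k.
Proof.
have /ker_inclP[k' _ k'E] : f v (rep_map X a (ker_incl (f u) k)) = 0.
  rewrite rep_nat (_ : f u _ = 0) ?linear0 //.
  by apply/ker_inclP; exists k.
by exists k'.
Qed.

Definition kerrep : zrep :=
  subrep (fun v => @ker_incl_inj _ _ _ (f v)) kerrep_stable.

Definition kerrep_incl : zrep_mor kerrep X := subrep_incl _ _.

Fact cokerrep_stable u v (a : zarrow u v) (y : Y u) :
  coker_proj (f u) y = 0 -> (coker_proj (f v) \o rep_map Y a) y = 0.
Proof.
move=> /coker_proj_eq0[x _ <-] /=; rewrite -rep_nat.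
by apply/coker_proj_eq0; exists (rep_map X a x).
Qed.

Definition cokerrep : zrep :=
  quotrep (fun v => @coker_proj_surj _ _ _ (f v)) cokerrep_stable.

Definition cokerrep_proj : zrep_mor Y cokerrep := quotrep_proj _ _.

Lemma rep_monoP : @is_mono P X Y f -> forall v, injective (f v).
Proof.
move=> f_mono v x y fxy.
have fi : @mcomp P _ _ _ f kerrep_incl = @mcomp P _ _ _ f (@zerom P _ _).
  apply: rep_ext => w k /=; rewrite linear0; apply/ker_inclP.
  by exists k.
have /ker_inclP[k _ kE] : f v (x - y) = 0 by rewrite linearB fxy subrr.
apply/eqP; rewrite -subr_eq0 -kE; apply/eqP.
exact: (rep_eq (f_mono _ _ _ fi) k).
Qed.

Lemma rep_epiP : @is_epi P X Y f -> forall v y, exists x, f v x = y.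
Proof.
move=> f_epi v y.
have fp : @mcomp P _ _ _ cokerrep_proj f = @mcomp P _ _ _ (@zerom P _ _) f.
  by apply: rep_ext => w x /=; apply/coker_proj_eq0; exists x.
have /coker_proj_eq0[x _ xE] : coker_proj (f v) y = 0.
  exact: (rep_eq (f_epi _ _ _ fp) y).
by exists x.
Qed.
End KernelCokernel.

Section DirectSum.
Variables X Y : zrep.

Definition sumrep : zrep.
Proof.
exists (fun v => (X v * Y v)%type)
  (fun u v a => pair_lin (rep_map X a \o fst) (rep_map Y a \o snd)) => j x;
  rewrite /= /pair_fun /=.
- by rewrite !rep_mesh0.
- by rewrite -[RHS]/(0, 0) -(rep_mesh1 x.1) -(rep_mesh1 x.2).
- by rewrite !rep_mesh2.
Defined.

Definition sumrep_in1 : zrep_mor X sumrep.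
Proof.
exists (fun v => pair_lin idfun \0) => u v a x.
by rewrite /= /pair_fun /= linear0.
Defined.

Definition sumrep_in2 : zrep_mor Y sumrep.
Proof.
exists (fun v => pair_lin \0 idfun) => u v a x.
by rewrite /= /pair_fun /= linear0.
Defined.

Definition sumrep_pr1 : zrep_mor sumrep X.
Proof. by exists (fun v => fst : {linear (X v * Y v)%type -> X v}). Defined.

Definition sumrep_pr2 : zrep_mor sumrep Y.
Proof. by exists (fun v => snd : {linear (X v * Y v)%type -> Y v}). Defined.

Lemma sumrepP :
  @is_biproduct P X Y sumrep sumrep_in1 sumrep_in2 sumrep_pr1 sumrep_pr2.
Proof.
split; first by split; apply: rep_ext => v x.
- move=> W f g.
  have hN u v (a : zarrow u v) (w : W u) :
      pair_lin (f v) (g v) (rep_map W a w) =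
      rep_map sumrep a (pair_lin (f u) (g u) w).
    by rewrite /= /pair_fun /= !rep_nat.
  exists (@ZRepMor W sumrep (fun v => pair_lin (f v) (g v)) hN); split; first by split; apply: rep_ext.
  move=> h [hf hg]; apply: rep_ext => v w /=; rewrite -hf -hg /=.
  by rewrite /pair_fun /=; case: (h v w).
- move=> Z f g.
  have hN u v (a : zarrow u v) (s : sumrep u) :
      copair_lin (f v) (g v) (rep_map sumrep a s) =
      rep_map Z a (copair_lin (f u) (g u) s).
    by rewrite /= /copair_fun /= !rep_nat linearD.
  exists (@ZRepMor sumrep Z (fun v => copair_lin (f v) (g v)) hN); split.
    split; apply: rep_ext => v x; rewrite /= /copair_fun /= linear0.
      by rewrite addr0.
    by rewrite add0r.
  move=> h [hf hg]; apply: rep_ext => v [x y] /=; rewrite -hf -hg /=.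
  rewrite /copair_fun /= -linearD; congr (h v _).
  by congr pair; rewrite /= ?addr0 ?add0r.
Qed.
End DirectSum.

Definition zerorep : zrep.
Proof.
by exists (fun v => 'rV[R]_0 : lmodType R) (fun u v a => \0) => j x;
  rewrite /= ?addr0.
Defined.

Definition repCat : abelianCategory.
Proof.
refine (@AbelianCategory P _ sumrep sumrep_in1 sumrep_in2 sumrep_pr1
  sumrep_pr2 sumrepP _ _ _ _).
- exists zerorep => X; split=> f; apply: rep_ext => v x.
    by apply/rowP => -[].
  by rewrite /= (_ : x = 0) ?linear0 //; apply/rowP => -[].
- move=> X Y f; exists (kerrep f), (kerrep_incl f).
  by apply: rep_is_kernel => v; [apply: ker_incl_inj | apply: ker_inclP].
- move=> X Y f; exists (cokerrep f), (cokerrep_proj f).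
  apply: rep_is_cokernel => v.
    exact: coker_proj_surj.
  exact: coker_proj_eq0.
- move=> X Y f /rep_monoP f_inj; exists (cokerrep f), (cokerrep_proj f).
  by apply: rep_is_kernel => // v x; apply: coker_proj_eq0.
- move=> X Y f /rep_epiP f_surj; exists (kerrep f), (kerrep_incl f).
  by apply: rep_is_cokernel => // v x; apply: ker_inclP.
Defined.

Definition exact_at (U V W : lmodType R) (f : {linear U -> V})
    (g : {linear V -> W}) :=
  range f = [set y | g y = 0].

(* The maps to and from the middle term of the squares are indexed by the
   source (j, 1) and target (j - 1, 1) of the square. *)
Definition square_in X (j : int) :
    {linear X (j, L1) -> (X (j - 1, L0) * X (j, L2))%type} :=
  pair_lin (rep_map X (a10 j)) (rep_map X (a12 j)).

Definition square_out X (j : int) :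
    {linear (X (j - 1, L0) * X (j, L2))%type -> X (j - 1, L1)} :=
  copair_lin (rep_map X (a01 (j - 1))) (rep_map X (a21 j)).

Definition mesh_exact X :=
  forall j : int,
  [/\ exact_at (rep_map X (a01 j)) (rep_map X (a10 j)),
      exact_at (square_in X j) (square_out X j) &
      exact_at (rep_map X (a21 j)) (rep_map X (a12 (j - 1)))].

(* Since j ranges over all integers, the middle cokernel is taken at the
   vertex (j - 1, 1) rather than at (j, 1), to avoid identifying the types
   X (j + 1 - 1, 1) and X (j, 1). *)
Definition Phi (A : modCat R -> Prop) (X : repCat) : Prop :=
  (forall j : int,
     [/\ A (Coker (rep_map X (a10 j))), A (Coker (square_out X j)) &
         A (Coker (rep_map X (a12 j)))]) /\
  mesh_exact X.

Definition Psi (B : modCat R -> Prop) (X : repCat) : Prop :=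
  (forall j : int,
     [/\ B (Ker (rep_map X (a01 j))), B (Ker (square_in X j)) &
         B (Ker (rep_map X (a21 j)))]) /\
  mesh_exact X.

End Representations.

Arguments rep_map {R} X {u v} _ : rename.

(* Main.v *)
From HB Require Import structures.
Require Import Defs.
From mathcomp Require Import all_boot all_order all_algebra all_classical.
Import GRing.Theory.
Local Open Scope ring_scope.

Set Implicit Arguments.
Unset Strict Implicit.
Unset Printing Implicit Defensive.

(** Write S for the permutation of the vertices sending v to the end of the
    longest nonzero path starting at v (S is [nv], and [nak] is the action of
    these paths). If the mesh complexes of X are exact, that path identifies
    the cokernel of the arrows into v with the kernel of the arrows out of S v;
    this makes exactness pass to kernels and cokernels and yields the closure
    of Phi(A) under kernels of epimorphisms and of Psi(B) under cokernels of
    monomorphisms.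

    Phi(A) is the left Ext-orthogonal of the representations with zero arrows
    and values in B, and dually for Psi(B), so both classes belong to cotorsion
    pairs. Failure of exactness of X at a mesh is detected by an extension of X
    by such a representation with Ext-injective values. Here k enters:
    Hom_k(R, M) is Ext-injective, because a subspace of a vector space has a
    complement, and contains M.

    A family (M_v) generates a free representation F(M) and cogenerates a
    cofree one G(M). Free representations cover every object from Phi(A), which
    gives closure of the right orthogonal of Phi(A) under cokernels of
    monomorphisms; dually for Psi(B).

    For compatibility, Y in Psi(B) has a filtration of length 3 whose layers
    have zero arrows and values in B, so Ext^1(Phi(A), Psi(B)) = 0. If X lies in
    Phi(A) and its right orthogonal, then the cokernel of X -> G(X) is again in
    Phi(A), hence X is a direct summand of G(X); thus the kernel of the arrows
    out of v is a direct summand of X_v, which is in B since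
    Ext^1(F(A), X) = 0. *)

(** * Closure conditions expressed with short exact sequences *)

Section ClosureConditions.
Variable C : abelianCategory.

Lemma cokernel_epi (X Y Q : C) (f : mor X Y) (p : mor Y Q) :
  is_cokernel f p -> is_epi p.
Proof.
move=> [pf0 pU] Z g h gh; have [|u [_ uu]] := pU Z (g \oc p).
  by rewrite -mcompA pf0 mcompm0.
by rewrite -(uu g erefl) -(uu h (esym gh)).
Qed.

Lemma kernel_mono (K X Y : C) (f : mor X Y) (i : mor K X) :
  is_kernel f i -> is_mono i.
Proof.
move=> [fi0 iU] W g h gh; have [|u [_ uu]] := iU W (i \oc g).
  by rewrite mcompA fi0 mcomp0m.
by rewrite -(uu g erefl) -(uu h (esym gh)).
Qed.

(** The epimorphism [f] is the cokernel of some [g], and [g] factors through the kernel [i]. A map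
    killing [i] thus kills [g] and descends along [f]. *)
Lemma epi_short_exact (K X Y : C) (f : mor X Y) (i : mor K X) :
  is_epi f -> is_kernel f i -> short_exact i f.
Proof.
move=> /epi_normal[Z [g [fg0 fU]]] ker_i; split=> //.
have [fi0 iU] := ker_i; split=> // T t ti0; apply: fU.
by have [h [<- _]] := iU Z g fg0; rewrite mcompA ti0 mcomp0m.
Qed.

Lemma mono_short_exact (X Y Q : C) (f : mor X Y) (p : mor Y Q) :
  is_mono f -> is_cokernel f p -> short_exact f p.
Proof.
move=> /mono_normal[Z [g [gf0 fU]]] coker_p; split=> //.
have [pf0 pU] := coker_p; split=> // T t pt0; apply: fU.
by have [h [<- _]] := pU Z g gf0; rewrite -mcompA pt0 mcompm0.
Qed.

Lemma closed_ker_epiP (Gamma : C -> Prop) : closed_ker_epi Gamma <->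
  (forall (K X Y : C) (i : mor K X) (f : mor X Y), short_exact i f ->
     Gamma X -> Gamma Y -> Gamma K).
Proof.
split=> [cl K X Y i f [ker_i /cokernel_epi]|cl K X Y f i f_epi ker_i].
  by move=> f_epi; apply: cl ker_i.
exact: cl (epi_short_exact f_epi ker_i).
Qed.

Lemma closed_coker_monoP (Delta : C -> Prop) : closed_coker_mono Delta <->
  (forall (X Y Q : C) (f : mor X Y) (p : mor Y Q), short_exact f p ->
     Delta X -> Delta Y -> Delta Q).
Proof.
split=> [cl X Y Q f p [/kernel_mono]|cl X Y Q f p f_mono coker_p].
  by move=> f_mono coker_p; apply: cl coker_p.
exact: cl (mono_short_exact f_mono coker_p).
Qed.

End ClosureConditions.

(** * Vanishing of Ext^1 for modules: splittings, pushouts and pullbacks *)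

Section ModuleExt.
Variable R : pzRingType.
Implicit Types K F Q U V W X Y : lmodType R.

Definition mod_exact U V W (i : {linear U -> V}) (p : {linear V -> W}) :=
  [/\ injective i, forall w, exists v, p v = w &
      forall v, p v = 0 <-> exists u, i u = v].

Lemma ker0_inj U V (f : {linear U -> V}) :
  (forall x, f x = 0 -> x = 0) -> injective f.
Proof.
move=> f0 x y fxy; apply/eqP; rewrite -subr_eq0; apply/eqP/f0.
by rewrite linearB fxy subrr.
Qed.

Lemma mod_exactP U V W (i : {linear U -> V}) (p : {linear V -> W}) :
  @short_exact (modPointed R) U V W i p <-> mod_exact i p.
Proof.
split=> [[ker_i coker_p]|[i_inj p_surj ip]]; last first.
  split; first by apply: mod_is_kernel => // v; rewrite ip; split=> -[u];
    [exists u|exists u].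
  by apply: mod_is_cokernel => // v; rewrite ip; split=> -[u]; [exists u|exists u].
have i_inj : injective i.
  apply: mod_monoP => T g h gh; case: ker_i => pi0 /(_ T (i \o g)).
  have pig : p \o (i \o g) = \0 :> {linear T -> W}.
    by apply: lin_ext => t /=; exact: (lin_eq pi0 (g t)).
  by move=> /(_ pig)[u [_ uu]]; rewrite -(uu g erefl) -(uu h (esym gh)).
have p_surj : forall w, exists v, p v = w.
  apply: mod_epiP => T g h gh; case: coker_p => pi0 /(_ T (g \o p)).
  have gpi : (g \o p) \o i = \0 :> {linear U -> T}.
    apply: lin_ext => t /=; rewrite [p (i t)](lin_eq pi0 t).
    exact: linear0.
  by move=> /(_ gpi)[u [_ uu]]; rewrite -(uu g erefl) -(uu h (esym gh)).
split=> // v; split=> [pv|[u <-]]; last by case: ker_i => /lin_eq /(_ u).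
case: ker_i => _ /(_ (Ker p) (ker_incl p)).
have pk : p \o ker_incl p = \0 :> {linear Ker p -> W}.
  by apply: lin_ext => k /=; apply/ker_inclP; exists k.
move=> /(_ pk)[h [/lin_eq hE _]]; have [k _ <-] := (ker_inclP p v).1 pv.
by exists (h k); apply: hE.
Qed.

Lemma mod_coker U V (i : {linear U -> V}) : injective i ->
  mod_exact i (coker_proj i).
Proof.
move=> i_inj; split=> //; first exact: coker_proj_surj.
by move=> v; rewrite coker_proj_eq0; split=> -[u]; [exists u|exists u].
Qed.

Lemma mod_ker U V (p : {linear U -> V}) : (forall v, exists u, p u = v) ->
  mod_exact (ker_incl p) p.
Proof.
move=> p_surj; split=> [|//|v]; first exact: (@ker_incl_inj _ _ _ p).
by rewrite ker_inclP; split=> -[u]; [exists u|exists u].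
Qed.

(** The endomorphism [1 - i r] vanishes on the kernel of [p], so it descends along [p] to a
    section. *)
Lemma mod_retract_section U V W (i : {linear U -> V}) (p : {linear V -> W})
    (r : {linear V -> U}) : mod_exact i p -> (forall u, r (i u) = u) ->
  exists s : {linear W -> V}, forall w, p (s w) = w.
Proof.
move=> [i_inj p_surj ip] ri; pose e := (idfun : {linear V -> V}) \- (i \o r).
have pe v : p v = 0 -> e v = 0.
  by move=> /ip[u <-]; rewrite /e /= ri subrr.
exists (lin_desc p_surj pe) => w; have [v <-] := p_surj w.
rewrite lin_descE /= linearB /= (_ : p (i _) = 0) ?subr0 //.
by apply/ip; exists (r v).
Qed.

Lemma mod_section_retract U V W (i : {linear U -> V}) (p : {linear V -> W})
    (s : {linear W -> V}) : mod_exact i p -> (forall w, p (s w) = w) ->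
  exists r : {linear V -> U}, forall u, r (i u) = u.
Proof.
move=> [i_inj p_surj ip] ps; pose e := (idfun : {linear V -> V}) \- (s \o p).
have ie v : exists u, i u = e v.
  by apply/ip; rewrite /e /= linearB /= ps subrr.
exists (lin_lift i_inj ie) => u; apply: (i_inj); rewrite lin_liftE /e /=.
by rewrite (_ : p (i u) = 0) ?linear0 ?subr0 ?addr0 //; apply/ip; exists u.
Qed.

(** An equivalence with the split extension, restricted to the summand [X], is a section of [p];
    conversely [i] and a section assemble to such an equivalence. *)
Lemma mod_Ext1P X Y : Ext1_zero (C := modCat R) X Y <->
  (forall (E : lmodType R) (i : {linear Y -> E}) (p : {linear E -> X}),
     mod_exact i p -> exists s : {linear X -> E}, forall x, p (s x) = x).
Proof.
split=> [ext0 E i p ip|sec [E i p ip]].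
  have [phi [_ /lin_eq pphi]] :=
    ext0 (@Extension (modCat R) _ _ _ _ _ ((mod_exactP i p).2 ip)).
  exists (phi \o (pair_lin \0 idfun : {linear X -> (Y * X)%type})) => x.
  rewrite [LHS]pphi /= /copair_fun /=.
  by rewrite add0r.
have /mod_exactP[i_inj p_surj ker_p] := ip.
have [s ps] := sec _ _ _ ((mod_exactP i p).1 ip).
exists (copair_lin i s); split; apply: lin_ext => x /=; rewrite /copair_fun /=.
  by rewrite linear0 addr0.
rewrite linearD ps; congr (_ + _).
by apply/ker_p; exists x.1.
Qed.

Lemma mod_Ext1_retr X Y : Ext1_zero (C := modCat R) X Y <->
  (forall (E : lmodType R) (i : {linear Y -> E}) (p : {linear E -> X}),
     mod_exact i p -> exists r : {linear E -> Y}, forall y, r (i y) = y).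
Proof.
rewrite mod_Ext1P; split=> h E i p ip; have [f fP] := h E i p ip.
  exact: mod_section_retract ip fP.
exact: mod_retract_section ip fP.
Qed.

Definition prod_map (U U' V V' : lmodType R) (f : {linear U -> V})
    (g : {linear U' -> V'}) : {linear (U * U')%type -> (V * V')%type} :=
  pair_lin (f \o fst) (g \o snd).

Lemma prod_map_exact (U V W U' V' W' : lmodType R)
    (i : {linear U -> V}) (p : {linear V -> W})
    (i' : {linear U' -> V'}) (p' : {linear V' -> W'}) :
  mod_exact i p -> mod_exact i' p' ->
  mod_exact (prod_map i i') (prod_map p p').
Proof.
move=> [i1 p1 ip1] [i2 p2 ip2].
split=> [[x y] [x' y'] /= [/i1 -> /i2 ->] //|[x y]|[x y]].
  by have [x' <-] := p1 x; have [y' <-] := p2 y; exists (x', y').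
split=> [[/ip1[x' <-] /ip2[y' <-]]|[[x' y'] [<- <-]]].
  by exists (x', y').
by congr pair; [apply/ip1; exists x'|apply/ip2; exists y'].
Qed.

Section Pushout.
Variables (K F X Y O : lmodType R) (i : {linear K -> F}) (p : {linear F -> X}).
Variables (g : {linear K -> Y}) (q : {linear (Y * F)%type -> O}).
Hypotheses (ip : mod_exact i p) (q_surj : forall o, exists z, q z = o).
Hypothesis qP : forall z, q z = 0 <-> exists k, z = (g k, - i k).

Let inY : {linear Y -> O} := q \o (pair_lin idfun \0).

Fact po_ker z : q z = 0 -> (p \o snd) z = 0.
Proof.
move=> /qP[k ->] /=; rewrite linearN (_ : p (i k) = 0) ?oppr0 //.
by case: ip => _ _ ->; exists k.
Qed.

Definition po_proj : {linear O -> X} := lin_desc q_surj po_ker.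

Lemma po_projE z : po_proj (q z) = p z.2. Proof. exact: lin_descE. Qed.

Lemma po_comm k : q (g k, 0) = q (0, i k).
Proof.
apply/eqP; rewrite -subr_eq0 -linearB; apply/eqP/qP; exists k.
by congr pair; rewrite /= ?subr0 ?sub0r.
Qed.

(** The pushout [O] is any quotient of [Y * F] by the antidiagonal image of [K], not a fixed
    construction, so that the lemma applies at each vertex of a cokernel representation. *)
Lemma po_exact : mod_exact inY po_proj.
Proof.
have [i_inj p_surj ker_p] := ip; split=> [y y' /eqP| x | o].
- rewrite -subr_eq0 -linearB /= => /eqP/qP[k [/= yE]].
  move=> /eqP; rewrite eq_sym oppr_eq0 => /eqP ik.
  have k0 : k = 0 by apply: i_inj; rewrite ik linear0.
  by apply/eqP; rewrite -subr_eq0 yE k0 linear0.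
- have [f <-] := p_surj x; exists (q (0, f)).
  by rewrite po_projE.
- split=> [|[y <-]]; last by rewrite [LHS]po_projE /= linear0.
  have [[y f] <-] := q_surj o; rewrite po_projE => /ker_p[k /= <-].
  exists (y + g k); rewrite /= /pair_fun /=.
  have -> : (y + g k, 0) = (y, 0) + (g k, 0) :> (Y * F)%type.
    by congr pair; rewrite /= addr0.
  rewrite linearD po_comm -linearD.
  by congr (q _); congr pair; rewrite /= ?addr0 ?add0r.
Qed.
End Pushout.

Section Pullback.
Variables (Y F Q X O : lmodType R) (i : {linear Y -> F}) (p : {linear F -> Q}).
Variables (g : {linear X -> Q}) (m : {linear O -> (F * X)%type}).
Hypotheses (ip : mod_exact i p) (m_inj : injective m).
Hypothesis mP : forall z, (exists o, m o = z) <-> p z.1 = g z.2.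

Fact pb_im y : exists o, m o = pair_lin i \0 y.
Proof.
apply/mP; rewrite /= linear0.
by case: ip => _ _ ->; exists y.
Qed.

Definition pb_inj : {linear Y -> O} := lin_lift m_inj pb_im.

Lemma pb_injE y : m (pb_inj y) = (i y, 0). Proof. exact: lin_liftE. Qed.

Lemma pb_exact : mod_exact pb_inj (snd \o m).
Proof.
have [i_inj p_surj ker_p] := ip; split=> [y y' /(congr1 m)| x | o].
- by rewrite !pb_injE => -[/i_inj].
- have [f fE] := p_surj (g x).
  by have [|o oE] := (mP (f, x)).2; [|exists o; rewrite /= oE].
- split=> [/= o0|[y <-]]; last by rewrite /= pb_injE.
  have mo : p (m o).1 = g (m o).2 by apply/mP; exists o.
  have : p (m o).1 = 0 by rewrite mo o0 linear0.
  move=> /ker_p[y yE]; exists y; apply: m_inj; rewrite pb_injE yE.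
  by case: (m o) o0 => ? ? /= ->.
Qed.
End Pullback.

(** The pushout along [g] is an extension of [X] by [Y]; its retraction, restricted to [F], extends
    [g]. *)
Lemma mod_extend X Y : Ext1_zero (C := modCat R) X Y ->
  forall K F (i : {linear K -> F}) (p : {linear F -> X}) (g : {linear K -> Y}),
  mod_exact i p -> exists h : {linear F -> Y}, forall k, h (i k) = g k.
Proof.
move=> /mod_Ext1_retr ext0 K F i p g ip; pose d := pair_lin g (\- i).
have dP z : coker_proj d z = 0 <-> exists k, z = (g k, - i k).
  by rewrite coker_proj_eq0; split=> [[k _ <-]|[k ->]]; exists k.
have [r rE] := ext0 _ _ _ (po_exact ip (coker_proj_surj (f:=d)) dP).
exists (r \o (coker_proj d \o pair_lin \0 idfun)) => k.
by rewrite -[RHS]rE; congr (r _); apply/esym/(po_comm dP).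
Qed.

(** The pullback along [g] is an extension of [X] by [Y]; its section, projected to [F], lifts
    [g]. *)
Lemma mod_lift X Y : Ext1_zero (C := modCat R) X Y ->
  forall F Q (i : {linear Y -> F}) (p : {linear F -> Q}) (g : {linear X -> Q}),
  mod_exact i p -> exists h : {linear X -> F}, forall x, p (h x) = g x.
Proof.
move=> /mod_Ext1P ext0 F Q i p g ip; pose d := copair_lin p (\- g).
have dP z : (exists o, ker_incl d o = z) <-> p z.1 = g z.2.
  transitivity (d z = 0).
    by rewrite ker_inclP; split=> [[k <-]|[k _ <-]]; exists k.
  rewrite /d /= /copair_fun /=.
  by split=> [/eqP|->]; rewrite ?subr_eq0 ?subrr // => /eqP.
have [s sE] := ext0 _ _ _ (pb_exact ip (@ker_incl_inj _ _ _ d) dP).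
exists (fst \o (ker_incl d \o s)) => x.
rewrite -[in RHS](sE x); apply/dP; by exists (s x).
Qed.

Lemma Ext1_retractr X Y Y' (s : {linear Y' -> Y}) (r : {linear Y -> Y'}) :
  (forall y, r (s y) = y) -> Ext1_zero (C := modCat R) X Y ->
  Ext1_zero (C := modCat R) X Y'.
Proof.
move=> rs ext0; apply/mod_Ext1_retr => E i p ip.
have [h hE] := mod_extend ext0 s ip.
by exists (r \o h) => y; rewrite /= hE rs.
Qed.

Lemma Ext1_retractl X X' Y (s : {linear X' -> X}) (r : {linear X -> X'}) :
  (forall x, r (s x) = x) -> Ext1_zero (C := modCat R) X Y ->
  Ext1_zero (C := modCat R) X' Y.
Proof.
move=> rs ext0; apply/mod_Ext1P => E i p ip.
have [h hE] := mod_lift ext0 r ip.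
by exists (h \o s) => y; rewrite /= hE rs.
Qed.

Lemma Ext1_prodr X Y Y' : Ext1_zero (C := modCat R) X Y ->
  Ext1_zero (C := modCat R) X Y' -> Ext1_zero (C := modCat R) X (Y * Y')%type.
Proof.
move=> ext0 ext0'; apply/mod_Ext1_retr => E i p ip.
have [h hE] := mod_extend ext0 (fst : {linear (Y * Y')%type -> Y}) ip.
have [h' hE'] := mod_extend ext0' (snd : {linear (Y * Y')%type -> Y'}) ip.
by exists (pair_lin h h') => -[y y'] /=; rewrite /pair_fun hE hE'.
Qed.

Lemma Ext1_prodl X X' Y : Ext1_zero (C := modCat R) X Y ->
  Ext1_zero (C := modCat R) X' Y -> Ext1_zero (C := modCat R) (X * X')%type Y.
Proof.
move=> ext0 ext0'; apply/mod_Ext1P => E i p ip.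
have [h hE] := mod_lift ext0 (pair_lin idfun \0 : {linear X -> (X * X')%type}) ip.
have [h' hE'] := mod_lift ext0' (pair_lin \0 idfun : {linear X' -> (X * X')%type}) ip.
exists (copair_lin h h') => -[x x'] /=; rewrite /copair_fun /= linearD hE hE'.
by congr pair; rewrite /= ?addr0 ?add0r.
Qed.

End ModuleExt.

(** * Vanishing of Ext^1 for representations *)

Section RepresentationExt.
Variable R : pzRingType.
Implicit Types E F K Q X Y Z : zrep R.

Definition rep_exact X Y Z (i : zrep_mor X Y) (p : zrep_mor Y Z) :=
  forall v, mod_exact (i v) (p v).

(** Kernels and cokernels of representations are computed vertexwise; comparison with the explicit
    kernel [kerrep p] gives exactness in the middle. *)
Lemma rep_exactP X Y Z (i : zrep_mor X Y) (p : zrep_mor Y Z) :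
  @short_exact (repPointed R) X Y Z i p <-> rep_exact i p.
Proof.
split=> [[ker_i coker_p]|ip]; last first.
  have [i_inj p_surj ker_p] : [/\ forall v, injective (i v),
      forall v z, exists y, p v y = z &
      forall v y, p v y = 0 <-> exists x, i v x = y].
    by split=> v; case: (ip v).
  split; first by apply: rep_is_kernel => // v y; rewrite ker_p; split=> -[x];
    [exists x|exists x].
  by apply: rep_is_cokernel => // v y; rewrite ker_p; split=> -[x];
    [exists x|exists x].
have i_inj : forall v, injective (i v).
  apply: rep_monoP => T g h gh; case: ker_i => pi0 /(_ T (rep_comp i g)).
  have pig : rep_comp p (rep_comp i g) = rep_zero T Z.
    by apply: rep_ext => v t /=; exact: (rep_eq pi0 (g v t)).
  by move=> /(_ pig)[u [_ uu]]; rewrite -(uu g erefl) -(uu h (esym gh)).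
have p_surj : forall v z, exists y, p v y = z.
  apply: rep_epiP => T g h gh; case: coker_p => pi0 /(_ T (rep_comp g p)).
  have gpi : rep_comp (rep_comp g p) i = rep_zero X T.
    apply: rep_ext => v t /=; rewrite [p v (i v t)](rep_eq pi0 t).
    exact: linear0.
  by move=> /(_ gpi)[u [_ uu]]; rewrite -(uu g erefl) -(uu h (esym gh)).
move=> v; split=> // y; split=> [pv|[u <-]]; last first.
  by case: ker_i => /rep_eq /(_ v u).
case: ker_i => _ /(_ (kerrep p) (kerrep_incl p)).
have pk : rep_comp p (kerrep_incl p) = rep_zero (kerrep p) Z.
  by apply: rep_ext => w k /=; apply/ker_inclP; exists k.
move=> /(_ pk)[h [/rep_eq hE _]]; have [k _ <-] := (ker_inclP (p v) y).1 pv.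
by exists (h v k); apply: hE.
Qed.

Lemma rep_coker X Y (i : zrep_mor X Y) : (forall v, injective (i v)) ->
  rep_exact i (cokerrep_proj i).
Proof. by move=> i_inj v; apply: mod_coker. Qed.

Lemma rep_ker X Y (p : zrep_mor X Y) :
  (forall v y, exists x, p v x = y) -> rep_exact (kerrep_incl p) p.
Proof. by move=> p_surj v; apply: mod_ker. Qed.

Definition rep_addm X Y (f g : zrep_mor X Y) : zrep_mor X Y.
Proof.
by exists (fun v => f v \+ g v) => u v a x /=; rewrite !rep_nat linearD.
Defined.

Definition rep_oppm X Y (f : zrep_mor X Y) : zrep_mor X Y.
Proof. by exists (fun v => \- (f v)) => u v a x /=; rewrite rep_nat linearN. Defined.

Definition rep_pair X Y Z (f : zrep_mor X Y) (g : zrep_mor X Z) :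
  zrep_mor X (sumrep Y Z).
Proof.
by exists (fun v => pair_lin (f v) (g v)) => u v a x;
  rewrite /= /pair_fun /= !rep_nat.
Defined.

Definition rep_copair X Y Z (f : zrep_mor X Z) (g : zrep_mor Y Z) :
  zrep_mor (sumrep X Y) Z.
Proof.
by exists (fun v => copair_lin (f v) (g v)) => u v a x;
  rewrite /= /copair_fun /= !rep_nat linearD.
Defined.

Lemma rep_desc_ex X Y Z (p : zrep_mor X Y) (g : zrep_mor X Z) :
  (forall v y, exists x, p v x = y) -> (forall v x, p v x = 0 -> g v x = 0) ->
  exists h : zrep_mor Y Z, forall v x, h v (p v x) = g v x.
Proof.
move=> p_surj g_ker; pose h v := lin_desc (p_surj v) (g_ker v).
have hE v x : h v (p v x) = g v x by apply: lin_descE.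
have hN u v (a : zarrow u v) y : h v (rep_map Y a y) = rep_map Z a (h u y).
  by have [x <-] := p_surj u y; rewrite -rep_nat !hE rep_nat.
by exists (ZRepMor hN).
Qed.

Lemma rep_lift_ex X Y Z (i : zrep_mor X Y) (g : zrep_mor Z Y) :
  (forall v, injective (i v)) -> (forall v z, exists x, i v x = g v z) ->
  exists h : zrep_mor Z X, forall v z, i v (h v z) = g v z.
Proof.
move=> i_inj g_im; pose h v := lin_lift (i_inj v) (g_im v).
have hE v z : i v (h v z) = g v z by apply: lin_liftE.
have hN u v (a : zarrow u v) z : h v (rep_map Z a z) = rep_map X a (h u z).
  by apply: (i_inj); rewrite rep_nat !hE rep_nat.
by exists (ZRepMor hN).
Qed.

Lemma rep_retract_section X Y Z (i : zrep_mor X Y) (p : zrep_mor Y Z)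
    (r : zrep_mor Y X) : rep_exact i p -> (forall v x, r v (i v x) = x) ->
  exists s : zrep_mor Z Y, forall v z, p v (s v z) = z.
Proof.
move=> ip ri; pose e := rep_addm (rep_id Y) (rep_oppm (rep_comp i r)).
have p_surj v : forall z, exists y, p v y = z by case: (ip v).
have pe v y : p v y = 0 -> e v y = 0.
  by case: (ip v) => _ _ -> [x <-]; rewrite /= ri subrr.
have [s sE] := rep_desc_ex p_surj pe.
exists s => v z; have [y <-] := p_surj v z.
rewrite sE /= linearB /= (_ : p v (i v _) = 0) ?subr0 //.
by case: (ip v) => _ _ ->; exists (r v y).
Qed.

Lemma rep_section_retract X Y Z (i : zrep_mor X Y) (p : zrep_mor Y Z)
    (s : zrep_mor Z Y) : rep_exact i p -> (forall v z, p v (s v z) = z) ->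
  exists r : zrep_mor Y X, forall v x, r v (i v x) = x.
Proof.
move=> ip ps; pose e := rep_addm (rep_id Y) (rep_oppm (rep_comp s p)).
have i_inj v : injective (i v) by case: (ip v).
have ie v y : exists x, i v x = e v y.
  by case: (ip v) => _ _ <-; rewrite /= linearB /= ps subrr.
have [r rE] := rep_lift_ex i_inj ie.
exists r => v x; apply: (i_inj); rewrite rE /=.
have -> : p v (i v x) = 0 by case: (ip v) => _ _ ->; exists x.
by rewrite linear0 subr0.
Qed.

Lemma rep_Ext1P X Y : Ext1_zero (C := repCat R) X Y <->
  (forall E (i : zrep_mor Y E) (p : zrep_mor E X), rep_exact i p ->
     exists s : zrep_mor X E, forall v x, p v (s v x) = x).
Proof.
split=> [ext0 E i p ip|sec [E i p ip]].
  have [phi [_ /rep_eq pphi]] :=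
    ext0 (@Extension (repCat R) _ _ _ _ _ ((rep_exactP i p).2 ip)).
  exists (rep_comp phi (sumrep_in2 Y X)) => v x.
  exact: pphi.
have ip' := (rep_exactP i p).1 ip.
have [s ps] := sec _ _ _ ip'.
exists (rep_copair i s); split; apply: rep_ext => v x /=; rewrite /copair_fun /=.
  by rewrite linear0 addr0.
rewrite linearD ps (_ : p v (i v _) = 0) ?add0r //.
by case: (ip' v) => _ _ ->; exists x.1.
Qed.

Lemma rep_Ext1_retr X Y : Ext1_zero (C := repCat R) X Y <->
  (forall E (i : zrep_mor Y E) (p : zrep_mor E X), rep_exact i p ->
     exists r : zrep_mor E Y, forall v y, r v (i v y) = y).
Proof.
rewrite rep_Ext1P; split=> h E i p ip; have [f fP] := h E i p ip.
  exact: rep_section_retract ip fP.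
exact: rep_retract_section ip fP.
Qed.

Lemma rep_extend X Y : Ext1_zero (C := repCat R) X Y ->
  forall K F (i : zrep_mor K F) (p : zrep_mor F X) (g : zrep_mor K Y),
  rep_exact i p ->
  exists h : zrep_mor F Y, forall v k, h v (i v k) = g v k.
Proof.
move=> /rep_Ext1_retr ext0 K F i p g ip; pose d := rep_pair g (rep_oppm i).
pose q := cokerrep_proj d.
have dP v z : q v z = 0 <-> exists k, z = (g v k, - i v k).
  by rewrite /= coker_proj_eq0; split=> [[k _ <-]|[k ->]]; exists k.
have q_surj v : forall z, exists y, q v y = z by apply: coker_proj_surj.
have qp v z : q v z = 0 -> (rep_comp p (sumrep_pr2 Y F)) v z = 0.
  by apply: po_ker => //; apply: dP.
have [p' pE] := rep_desc_ex q_surj qp.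
have ex : rep_exact (rep_comp q (sumrep_in1 Y F)) p'.
  move=> v; have [h1 h2 h3] := po_exact (ip v) (q_surj v) (dP v).
  have p'E z : p' v z = po_proj (ip v) (q_surj v) (dP v) z.
    by have [y <-] := q_surj v z; rewrite pE po_projE.
  split=> [y y' yy'|x|o]; first exact: h1.
    by have [o <-] := h2 x; exists o.
  by rewrite p'E h3.
have [r rE] := ext0 _ _ _ ex.
exists (rep_comp r (rep_comp q (sumrep_in2 Y F))) => v k.
by rewrite -[RHS]rE; congr (r v _); apply/esym/(po_comm (dP v)).
Qed.

Lemma rep_lift X Y : Ext1_zero (C := repCat R) X Y ->
  forall F Q (i : zrep_mor Y F) (p : zrep_mor F Q) (g : zrep_mor X Q),
  rep_exact i p ->
  exists h : zrep_mor X F, forall v x, p v (h v x) = g v x.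
Proof.
move=> /rep_Ext1P ext0 F Q i p g ip; pose d := rep_copair p (rep_oppm g).
pose m := kerrep_incl d.
have dP v z : (exists o, m v o = z) <-> p v z.1 = g v z.2.
  transitivity (d v z = 0).
    by rewrite ker_inclP; split=> [[k <-]|[k _ <-]]; exists k.
  rewrite /d /= /copair_fun /=.
  by split=> [/eqP|->]; rewrite ?subr_eq0 ?subrr // => /eqP.
have m_inj v : injective (m v) by apply: ker_incl_inj.
have im v y : exists o, m v o = rep_comp (sumrep_in1 F X) i v y.
  have [o oE] := pb_im (ip v) (dP v) y; exists o.
  by rewrite oE /= /pair_fun.
have [i' iE] := rep_lift_ex m_inj im.
have ex : rep_exact i' (rep_comp (sumrep_pr2 F X) m).
  move=> v; have [h1 h2 h3] := pb_exact (ip v) (m_inj v) (dP v).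
  have i'E y : i' v y = pb_inj (ip v) (m_inj v) (dP v) y.
    by apply: (m_inj); rewrite iE pb_injE.
  split=> [y y'|x|o]; first by rewrite !i'E; apply: h1.
    exact: h2.
  rewrite h3; split=> -[y yE]; exists y; first by rewrite i'E.
  by rewrite -i'E.
have [s sE] := ext0 _ _ _ ex.
exists (rep_comp (sumrep_pr1 F X) (rep_comp m s)) => v x.
rewrite -[in RHS](sE v x); apply/dP; by exists (s v x).
Qed.

(* pushing an extension out along [Y -> Y''] splits it, and the kernel of the
   resulting map to [Y''] is an extension by [Y'] *)
Lemma rep_Ext1_middle X Y' Y Y'' (i : zrep_mor Y' Y) (p : zrep_mor Y Y'') :
  rep_exact i p -> Ext1_zero (C := repCat R) X Y' ->
  Ext1_zero (C := repCat R) X Y'' -> Ext1_zero (C := repCat R) X Y.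
Proof.
move=> ip ext' ext''; apply/rep_Ext1P => E j q jq.
have [h hE] := rep_extend ext'' p jq.
have h_surj v z : exists e, h v e = z.
  have [_ p_surj _] := ip v; have [y <-] := p_surj z.
  by exists (j v y).
pose k := kerrep_incl h.
have k_inj v : injective (k v) by apply: ker_incl_inj.
have kP v e : h v e = 0 <-> exists x, k v x = e.
  by rewrite ker_inclP; split=> -[x]; [exists x|exists x].
have ji v y' : exists x, k v x = rep_comp j i v y'.
  by apply/kP; rewrite /= hE; case: (ip v) => _ _ ->; exists y'.
have [j' j'E] := rep_lift_ex k_inj ji.
have ex : rep_exact j' (rep_comp q k).
  move=> v; have [i_inj p_surj ker_p] := ip v.
  have [j_inj q_surj ker_q] := jq v.
  split=> [y y' /(congr1 (k v))|x|o].
  - by rewrite !j'E => /j_inj/i_inj.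
  - have [e <-] := q_surj x; have [y yE] := p_surj (h v e).
    have [|o oE] := (kP v (e - j v y)).1.
      by rewrite linearB hE yE subrr.
    exists o; transitivity (q v (e - j v y)); first by rewrite -oE.
    by rewrite linearB (_ : q v (j v y) = 0) ?subr0 //; apply/ker_q; exists y.
  - split=> [/ker_q[y yE]|[y' <-]].
      have py : p v y = 0 by rewrite -hE yE; apply/kP; exists o.
      have [y' y'E] := (ker_p y).1 py; exists y'.
      by apply: (k_inj); rewrite j'E /= y'E.
    transitivity (q v (j v (i v y'))); first exact: (congr1 (q v) (j'E v y')).
    by apply/ker_q; exists (i v y').
have [s sE] := (rep_Ext1P X Y').1 ext' _ _ _ ex.
by exists (rep_comp k s) => v x; apply: sE.
Qed.

(** Dimension shifting without Ext^2. The kernel K of the composite F -> E -> X is in [Gamma]. The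
    restriction K -> Y'' of [e] lifts to [Y] since Ext^1(K, Y') = 0, and the lift extends to F since
    Ext^1(X, Y) = 0. Subtracting the resulting map F -> Y -> Y'' -> E from [e] leaves a map that
    vanishes on K and descends to a section of [q]. *)
Lemma rep_coker_closed (Gamma : repCat R -> Prop) :
  closed_ker_epi Gamma ->
  (forall E, exists F (e : zrep_mor F E),
     Gamma F /\ forall v y, exists x, e v x = y) ->
  closed_coker_mono (rperp Gamma).
Proof.
move=> /closed_ker_epiP cl cover; apply/closed_coker_monoP.
move=> Y' Y Y'' i p /rep_exactP ip rY' rY X GX; apply/rep_Ext1P => E j q jq.
have [F [e [GF e_surj]]] := cover E.
have qe_surj v x : exists f, rep_comp q e v f = x.
  have [_ q_surj _] := jq v; have [y <-] := q_surj x.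
  by have [f <-] := e_surj v y; exists f.
have kqe := rep_ker qe_surj.
have GK : Gamma (kerrep (rep_comp q e)).
  by apply: (cl _ _ _ (kerrep_incl _) (rep_comp q e)) => //; apply/rep_exactP.
set k := kerrep_incl (rep_comp q e) in kqe.
have j_inj v : injective (j v) by case: (jq v).
have jk v x : exists y, j v y = rep_comp e k v x.
  have [_ _ jqv] := jq v; apply/jqv.
  by have [_ _ kv] := kqe v; apply/kv; exists x.
have [g gE] := rep_lift_ex j_inj jk.
have [g' g'E] := rep_lift (rY' _ GK) g ip.
have [h hE] := rep_extend (rY _ GX) g' kqe.
pose d := rep_addm e (rep_oppm (rep_comp j (rep_comp p h))).
have dk v f : rep_comp q e v f = 0 -> d v f = 0.
  have [_ _ kv] := kqe v; move=> /kv[x <-].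
  by rewrite /= [h v _]hE g'E gE subrr.
have [s sE] := rep_desc_ex qe_surj dk.
exists s => v x; have [f <-] := qe_surj v x.
rewrite sE /= linearB /= (_ : q v (j v _) = 0) ?subr0 //.
by have [_ _ jqv] := jq v; apply/jqv; exists (p v (h v f)).
Qed.

(** Dual to [rep_coker_closed]: the extension is embedded into an object F of [Delta], and the
    cokernel of Y -> F is again in [Delta]. *)
Lemma rep_ker_closed (Delta : repCat R -> Prop) :
  closed_coker_mono Delta ->
  (forall E, exists F (e : zrep_mor E F),
     Delta F /\ forall v, injective (e v)) ->
  closed_ker_epi (lperp Delta).
Proof.
move=> /closed_coker_monoP cl cover; apply/closed_ker_epiP.
move=> X' X X'' i p /rep_exactP ip lX lX'' Y DY; apply/rep_Ext1_retr => E j q jq.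
have [F [e [DF e_inj]]] := cover E.
have ej_inj v : injective (rep_comp e j v).
  by have [j_inj _ _] := jq v; move=> y y' /= /e_inj/j_inj.
have cej := rep_coker ej_inj.
have DQ : Delta (cokerrep (rep_comp e j)).
  by apply: (cl _ _ _ (rep_comp e j) (cokerrep_proj _)) => //; apply/rep_exactP.
set c := cokerrep_proj (rep_comp e j) in cej.
have q_surj v : forall x, exists y, q v y = x by case: (jq v).
have cq v y : q v y = 0 -> rep_comp c e v y = 0.
  have [_ _ jqv] := jq v; move=> /jqv[z <-].
  by have [_ _ cv] := cej v; apply/cv; exists z.
have [g gE] := rep_desc_ex q_surj cq.
have [g' g'E] := rep_extend (lX'' _ DQ) g ip.
have [h hE] := rep_lift (lX _ DY) g' cej.
pose d := rep_addm e (rep_oppm (rep_comp h (rep_comp i q))).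
have dk v f : exists y, rep_comp e j v y = d v f.
  have [_ _ cv] := cej v; apply/cv.
  rewrite -[d v f]/(e v f - h v (i v (q v f))) linearB.
  by rewrite [c v (h v _)]hE g'E gE subrr.
have [r rE] := rep_lift_ex ej_inj dk.
exists r => v y; apply: (ej_inj); rewrite rE /=.
have [_ _ jqv] := jq v; have -> : q v (j v y) = 0 by apply/jqv; exists y.
by rewrite !linear0 addr0.
Qed.

End RepresentationExt.

(** * Coinduced modules Hom_k(R, M), which are Ext-injective *)

Section CoinducedModule.
Variables (k : fieldType) (R : pzRingType) (iota : {rmorphism k -> R}).
Implicit Types E M X Y : lmodType R.

(** Zorn's lemma provides a maximal k-subspace meeting the image of [i] trivially; a vector [e]
    outside the sum could be adjoined to it. *)
Lemma subspace_complement Y E (i : {linear Y -> E}) : injective i ->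
  exists A : set E, [/\ forall c x y, A x -> A y -> A (iota c *: x + y),
    forall y, A (i y) -> y = 0 & forall e, exists y, A (e - i y)].
Proof.
move=> i_inj.
(* Membership of 0 is left out, because the union of the empty chain must satisfy [P]. A maximal [A]
   contains 0: otherwise it would be empty, and [[set 0]] would be larger. *)
pose P (A : set E) := (forall c x y, A x -> A y -> A (iota c *: x + y)) /\
  forall y, A (i y) -> y = 0.
have chainP (F : set (set E)) : (F `<=` P)%classic ->
    total_on F subset -> P (\bigcup_(A in F) A)%classic.
  move=> FP totF; split=> [c x y [A FA Ax] [B FB By]|y [A FA]]; last first.
    by have [_] := FP A FA; apply.
  have [AB|BA] := totF A B FA FB.
    by exists B => //; apply: (FP B FB).1 => //; apply: AB.
  by exists A => //; apply: (FP A FA).1 => //; apply: BA.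
have [A [[Aclosed Ai] Amax]] := Zorn_bigcup chainP.
have neg x : x \in A -> A 0.
  rewrite inE => Ax; have := Aclosed (-1) _ _ Ax Ax.
  by rewrite rmorphN1 scaleN1r addNr.
have A0 : A 0.
  apply: contrapT => nA0; apply: (Amax [set 0]%classic).
    split=> [x Ax|/(_ 0 erefl)//]; by case: nA0; apply: (neg x); rewrite inE.
  split=> [c x y /= -> ->|y /= iy]; first by rewrite scaler0 addr0.
  by apply: i_inj; rewrite iy linear0.
exists A; split=> // e; apply: contrapT => ne.
pose B : set E := fun x => exists c a, A a /\ x = iota c *: e + a.
apply: (Amax B); first split.
- by move=> a Aa; exists 0, a; split=> //; rewrite rmorph0 scale0r add0r.
- by move=> BA; apply: ne; exists 0; rewrite linear0 subr0; apply: BA;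
    exists 1, 0; split=> //; rewrite rmorph1 scale1r addr0.
split=> [c x y [c1 [a1 [Aa1 ->]]] [c2 [a2 [Aa2 ->]]]|y [c [a [Aa iy]]]].
  exists (c * c1 + c2), (iota c *: a1 + a2); split; first exact: Aclosed.
  by rewrite rmorphD rmorphM scalerDl scalerDr scalerA addrACA.
have [c0|c0] := eqVneq c 0.
  by apply: Ai; rewrite iy c0 rmorph0 scale0r add0r.
(* Solving [i y = iota c *: e + a] for [e] shows that [e - i (iota c^-1 *: y)] is a scalar multiple
   of [a]. *)
case: ne; exists (iota c^-1 *: y).
have -> : e - i (iota c^-1 *: y) = iota (- c^-1) *: a + 0.
  rewrite linearZ /= iy scalerDr scalerA -rmorphM mulVf // rmorph1 scale1r.
  by rewrite opprD addrA subrr add0r addr0 rmorphN scaleNr.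
exact: Aclosed.
Qed.

Lemma scalar_retraction Y E (i : {linear Y -> E}) : injective i ->
  exists r : E -> Y, [/\ {morph r : x y / x + y},
    forall c x, r (iota c *: x) = iota c *: r x & cancel i r].
Proof.
move=> i_inj; have [A [Aclosed Ai Asum]] := subspace_complement i_inj.
have A0 : A 0.
  have [y Ay] := Asum 0; have := Aclosed (-1) _ _ Ay Ay.
  by rewrite rmorphN1 scaleN1r addNr.
have AN x : A x -> A (- x).
  by move=> Ax; have := Aclosed (-1) _ _ Ax A0; rewrite rmorphN1 scaleN1r addr0.
have AD x y : A x -> A y -> A (x + y).
  by move=> Ax Ay; have := Aclosed 1 _ _ Ax Ay; rewrite rmorph1 scale1r.
pose r e := projT1 (cid (Asum e)).
have rA e : A (e - i (r e)) := projT2 (cid (Asum e)).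
have rP e y : A (e - i y) -> r e = y.
  move=> Ay; apply/eqP; rewrite -subr_eq0; apply/eqP/Ai.
  have <- : e - i y - (e - i (r e)) = i (r e - y).
    by rewrite [RHS]linearB opprB addrC addrA subrK.
  by apply: AD => //; apply: AN.
exists r; split=> [x y|c x|y]; apply: rP; last by rewrite subrr.
  by rewrite linearD opprD addrACA; apply: AD.
by rewrite linearZ -scalerBr -[_ *: _]addr0; apply: Aclosed.
Qed.

Variable M : lmodType R.

(** These functions form Hom_k(R, M), where k acts on [R] by left multiplication through [iota].
    Right multiplication on [R] makes it a left [R]-module, see [coind_scale]. *)
Definition scalar_linear (f : R -> M) :=
  {morph f : s t / s + t} /\ forall c s, f (iota c * s) = iota c *: f s.

Definition in_coind : {pred R -> M} := fun f => `[< scalar_linear f >].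

Fact in_coind_closed : zmod_closed in_coind.
Proof.
split=> [|f g /asboolP[fD fZ] /asboolP[gD gZ]]; apply/asboolP; split=> [s t|c s].
- by rewrite /= addr0.
- by rewrite /= scaler0.
- by rewrite !fctE fD gD opprD addrACA.
- by rewrite !fctE fZ gZ scalerBr.
Qed.

HB.instance Definition _ :=
  GRing.isZmodClosed.Build (R -> M) in_coind in_coind_closed.

Definition coind_type := {f : R -> M | f \in in_coind}.

HB.instance Definition _ := SubChoice.on coind_type.
HB.instance Definition _ := [SubChoice_isSubZmodule of coind_type by <:].

Fact coindE (f : coind_type) : scalar_linear (val f).
Proof. exact/asboolP/(valP f). Qed.

Fact coind_scale_subproof (a : R) (f : coind_type) :
  (fun s => val f (s * a)) \in in_coind.
Proof.
have [fD fZ] := coindE f.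
by apply/asboolP; split=> [s t|c s]; rewrite ?mulrDl ?fD // -mulrA fZ.
Qed.

Definition coind_scale a f : coind_type :=
  exist (fun g => g \in in_coind) _ (coind_scale_subproof a f).

Lemma coind_scaleE a f s : val (coind_scale a f) s = val f (s * a).
Proof. by []. Qed.

Lemma coind_ext (f g : coind_type) : val f =1 val g -> f = g.
Proof. by move=> fg; apply/val_inj/funext. Qed.

Fact coind_scaleA a b f : coind_scale a (coind_scale b f) = coind_scale (a * b) f.
Proof. by apply: coind_ext => s; rewrite !coind_scaleE mulrA. Qed.

Fact coind_scale1 : left_id 1 coind_scale.
Proof. by move=> f; apply: coind_ext => s; rewrite coind_scaleE mulr1. Qed.

Fact coind_scaleDr : right_distributive coind_scale +%R.
Proof. by move=> a f g; apply: coind_ext. Qed.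

Fact coind_scaleDl f : {morph coind_scale^~ f : a b / a + b}.
Proof.
move=> a b; apply: coind_ext => s; rewrite coind_scaleE mulrDr.
by have [-> _] := coindE f.
Qed.

HB.instance Definition _ := GRing.Zmodule_isLmodule.Build R coind_type
  coind_scaleA coind_scale1 coind_scaleDr coind_scaleDl.

Definition Coind : lmodType R := coind_type.

Fact coind_unit_subproof (x : M) : (fun s : R => s *: x) \in in_coind.
Proof.
by apply/asboolP; split=> [s t|c s]; rewrite ?scalerDl // scalerA.
Qed.

Definition coind_unit_fun (x : M) : Coind :=
  exist (fun g => g \in in_coind) _ (coind_unit_subproof x).

Fact coind_unit_linear : linear coind_unit_fun.
Proof.
move=> a x y; apply: coind_ext => s /=.
by rewrite scalerDr scalerA.
Qed.

HB.instance Definition _ :=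
  GRing.isLinear.Build R M Coind *:%R coind_unit_fun coind_unit_linear.

Definition coind_unit : {linear M -> Coind} := coind_unit_fun.

Lemma coind_unit_inj : injective coind_unit.
Proof.
by move=> x y /(congr1 (fun f : coind_type => val f 1)); rewrite /= !scale1r.
Qed.

(** This is the adjunction between restriction to k and coinduction: a k-linear retraction [r] of
    [i] yields the [R]-linear retraction sending [e] to the function whose value at [s] is
    [r (s *: e)] evaluated at 1. *)
Lemma Ext1_Coind X : Ext1_zero (C := modCat R) X Coind.
Proof.
apply/mod_Ext1_retr => E i p [i_inj _ _].
have [r [rD rZ ri]] := scalar_retraction i_inj.
have h_in e : (fun s : R => val (r (s *: e) : coind_type) 1) \in in_coind.
  by apply/asboolP; split=> [s t|c s];
    rewrite ?scalerDl ?rD // -scalerA rZ [LHS]coind_scaleE mul1r;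
    have [_ fZ] := coindE (r (s *: e)); rewrite -fZ mulr1.
pose h e : Coind := exist (fun g => g \in in_coind) _ (h_in e).
have h_lin : linear h.
  move=> a x y; apply: coind_ext => s; rewrite /= scalerDr scalerA rD.
  by [].
pose hL := GRing.isLinear.Build R E Coind *:%R h h_lin.
pose h' : {linear E -> Coind} := HB.pack h hL.
exists h' => y; apply: coind_ext => s.
rewrite -[LHS]/(val (r (s *: i y) : coind_type) 1) -linearZ ri.
by rewrite [LHS]coind_scaleE mul1r.
Qed.

End CoinducedModule.

(** * The free module on the elements of a module, as finitely supported functions *)

Section FreeModule.
Variables (R : pzRingType) (M : lmodType R).
Implicit Types N X Y : lmodType R.

Definition supported_by (s : seq M) (f : M -> R^o) :=
  forall x, x \notin s -> f x = 0.

Definition in_free : {pred M -> R^o} := fun f => `[< exists s, supported_by s f >].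

Fact in_free_closed : submod_closed in_free.
Proof.
split=> [|a f g /asboolP[s fs] /asboolP[t gt]]; apply/asboolP.
  by exists [::].
exists (s ++ t) => x; rewrite mem_cat negb_or => /andP[xs xt].
by rewrite !fctE fs // gt // scaler0 addr0.
Qed.

HB.instance Definition _ :=
  GRing.isSubmodClosed.Build R (M -> R^o) in_free in_free_closed.

Definition free_type := {f : M -> R^o | f \in in_free}.

HB.instance Definition _ := SubChoice.on free_type.
HB.instance Definition _ := [SubChoice_isSubLmodule of free_type by <:].

Definition Free : lmodType R := free_type.

Fact free_supp (f : free_type) : exists s, uniq s /\ supported_by s (val f).
Proof.
have /asboolP[s fs] := valP f; exists (undup s); rewrite undup_uniq.
by split=> // x; rewrite mem_undup; apply: fs.
Qed.

Definition delta_fun (x y : M) : R^o := (x == y)%:R.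

Fact delta_in x : delta_fun x \in in_free.
Proof.
by apply/asboolP; exists [:: x] => y; rewrite inE /delta_fun eq_sym => /negbTE ->.
Qed.

Definition free_gen (x : M) : Free := exist (fun g => g \in in_free) _ (delta_in x).

Section Lift.
Variables (N : lmodType R) (g : M -> N).

Definition free_lift_fun (f : Free) : N :=
  \sum_(x \in [set: M]) (val (f : free_type) x : R) *: g x.

Lemma free_liftE s (f : Free) : uniq s -> supported_by s (val (f : free_type)) ->
  free_lift_fun f = \sum_(x <- s) (val (f : free_type) x : R) *: g x.
Proof.
move=> us fs; rewrite /free_lift_fun (fsbigE s) //.
  by rewrite big_mkcond; apply: eq_bigr => x _; rewrite in_setT.
by move=> x _ /= xs; rewrite fs // scale0r.
Qed.

Fact free_lift_linear : linear free_lift_fun.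
Proof.
move=> a f h; have [s [us fs]] := free_supp f; have [t [ut ht]] := free_supp h.
have ur := undup_uniq (s ++ t).
have fr : supported_by (undup (s ++ t)) (val (f : free_type)).
  by move=> x; rewrite mem_undup mem_cat negb_or => /andP[/fs].
have hr : supported_by (undup (s ++ t)) (val (h : free_type)).
  by move=> x; rewrite mem_undup mem_cat negb_or => /andP[_ /ht].
have afhr : supported_by (undup (s ++ t)) (val (a *: f + h : free_type)).
  by move=> x xr; rewrite /= !fctE fr // hr // scaler0 addr0.
rewrite !(free_liftE ur) // scaler_sumr -big_split; apply: eq_bigr => x _ /=.
by rewrite scalerA -scalerDl.
Qed.

HB.instance Definition _ :=
  GRing.isLinear.Build R Free N *:%R free_lift_fun free_lift_linear.

Definition free_lift : {linear Free -> N} := free_lift_fun.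

Lemma free_lift_gen x : free_lift (free_gen x) = g x.
Proof.
rewrite [LHS](@free_liftE [:: x]) ?big_seq1 //=.
  by rewrite /delta_fun eqxx scale1r.
by move=> y; rewrite inE /= /delta_fun eq_sym => /negbTE ->.
Qed.
End Lift.

(** Chosen preimages of the generators define a section, which is checked on the expansion of [f] in
    generators. *)
Lemma Ext1_Free Y : Ext1_zero (C := modCat R) Free Y.
Proof.
apply/mod_Ext1P => E i p [_ p_surj _].
exists (free_lift (fun x => projT1 (cid (p_surj (free_gen x))))) => f.
have [s [us fs]] := free_supp f.
rewrite [free_lift _ _](free_liftE _ us fs) linear_sum /=.
apply/val_inj/funext => y; rewrite raddf_sum /= fct_sumE.
rewrite (eq_bigr (fun x => if x == y then (val (f : free_type) y : R^o) else 0)).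
  rewrite -big_mkcond big_const_seq count_uniq_mem //.
  case: (boolP (y \in s)) => [_|ys] /=; first exact: addr0.
  exact/esym/fs.
move=> x _; rewrite linearZ /= (projT2 (cid (p_surj (free_gen x)))) /=.
rewrite !fctE /delta_fun.
by case: eqP => [->|_]; rewrite ?scaler0 // -[LHS]/(_ * 1) mulr1.
Qed.

Lemma free_cover x : free_lift id (free_gen x) = x.
Proof. exact: free_lift_gen. Qed.

End FreeModule.

(** * Meshes, exactness at a mesh, and longest nonzero paths *)

Section Mesh.
Variable R : pzRingType.
Implicit Types (S T : vertex -> lmodType R) (X Y Z : zrep R).

(* The mesh with source [m] has target [vnext m] and middle term [Mid X m]. *)
Definition vnext (m : vertex) : vertex := (m.1 - 1, m.2).

Definition Mid T (m : vertex) : lmodType R :=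
  match m with
  | (j, L0) => T (j, L1)
  | (j, L1) => (T (j - 1, L0) * T (j, L2))%type
  | (j, L2) => T (j - 1, L1)
  end.

(** Source and target families may differ, since the cocycle of an extension maps one representation
    to the other. *)
Definition arrows S T := forall u v, zarrow u v -> {linear S u -> T v}.

Definition mesh_in S T (a : arrows S T) (m : vertex) : {linear S m -> Mid T m} :=
  match m with
  | (j, L0) => a _ _ (a01 j)
  | (j, L1) => pair_lin (a _ _ (a10 j)) (a _ _ (a12 j))
  | (j, L2) => a _ _ (a21 j)
  end.

Definition mesh_out S T (a : arrows S T) (m : vertex) :
    {linear Mid S m -> T (vnext m)} :=
  match m with
  | (j, L0) => a _ _ (a10 j)
  | (j, L1) => copair_lin (a _ _ (a01 (j - 1))) (a _ _ (a21 j))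
  | (j, L2) => a _ _ (a12 (j - 1))
  end.

Definition mid_map S T (f : forall v, {linear S v -> T v}) (m : vertex) :
    {linear Mid S m -> Mid T m} :=
  match m with
  | (j, L0) => f (j, L1)
  | (j, L1) => prod_map (f (j - 1, L0)) (f (j, L2))
  | (j, L2) => f (j - 1, L1)
  end.

Notation din X := (mesh_in (@rep_map _ X)).
Notation dout X := (mesh_out (@rep_map _ X)).

Lemma mesh_rel X m x : dout X m (din X m x) = 0.
Proof.
by case: m x => j [] x; rewrite /= ?rep_mesh0 ?rep_mesh2 //; apply: rep_mesh1.
Qed.

Definition mesh_rep (T : vertex -> lmodType R) (a : arrows T T)
  (rel : forall m x, mesh_out a m (mesh_in a m x) = 0) : zrep R.
Proof.
by exists T a => j x; [apply: (rel (j, L0))|apply: (rel (j, L1))|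
  apply: (rel (j, L2))].
Defined.

(** Working at [vnext m] spares the transport between the indices [j + 1 - 1] and [j]. *)
Lemma vertex_next_ind (P : vertex -> Prop) :
  (forall m, P (vnext m)) -> forall v, P v.
Proof. by move=> h [j l]; have := h (j + 1, l); rewrite /vnext /= addrK. Qed.

Lemma mid_map_din X Y (f : zrep_mor X Y) m x :
  mid_map f m (din X m x) = din Y m (f m x).
Proof.
by case: m x => j [] x; rewrite /= ?rep_nat // /pair_fun /= !rep_nat.
Qed.

Lemma mid_map_dout X Y (f : zrep_mor X Y) m z :
  f (vnext m) (dout X m z) = dout Y m (mid_map f m z).
Proof.
by case: m z => j [] z; rewrite /= ?rep_nat // /copair_fun linearD /= !rep_nat.
Qed.

Section MidExact.
Variables S T T' : vertex -> lmodType R.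
Variables (f : forall v, {linear S v -> T v}) (g : forall v, {linear T v -> T' v}).
Hypothesis fg : forall v, mod_exact (f v) (g v).

Lemma mid_exact m : mod_exact (mid_map f m) (mid_map g m).
Proof.
by case: m => j []; [exact: fg|exact: prod_map_exact|exact: fg].
Qed.
End MidExact.

Lemma din_eq0 X v x : din X v x = 0 <-> forall w (a : zarrow v w), rep_map X a x = 0.
Proof.
split=> [x0 w a|x0]; last first.
  by case: v x x0 => j [] x x0; rewrite /= ?x0 // /pair_fun !x0.
by case: v w / a x x0 => j x; rewrite /= // /pair_fun => -[].
Qed.

Definition kills_in X v (C : lmodType R) (c : X v -> C) :=
  forall u (a : zarrow u v) x, c (rep_map X a x) = 0.

(** Case analysis on the arrow [b] needs its target to be a variable; hence the equation [e] and the
    transport along it. *)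
Lemma kills_in_mesh X u v (b : zarrow u v) m (e : v = vnext m)
    (C : lmodType R) (c : {linear X (vnext m) -> C}) :
  (forall z, c (dout X m z) = 0) ->
  forall x, c (eq_rect v (fun v => X v : Type) (rep_map X b x) _ e) = 0.
Proof.
case: u v / b e => j; case: m c => i l c e; case: (e) => /= ji lE c0 x;
  [| |move: ji => /addIr ji|move: ji => /addIr ji];
  subst l j; rewrite (Prop_irrelevance e erefl) /=.
- by rewrite -(c0 (x, 0)) /= /copair_fun /= linear0 addr0.
- exact: c0.
- exact: c0.
- by rewrite -(c0 (0, x)) /= /copair_fun /= linear0 add0r.
Qed.

Lemma kills_inP X m (C : lmodType R) (c : {linear X (vnext m) -> C}) :
  kills_in c <-> forall z, c (dout X m z) = 0.
Proof.
split=> [c0 z|c0 u a x]; last exact: (kills_in_mesh a erefl c0).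
case: m z c c0 => j [] z c c0; rewrite /= ?c0 //.
by rewrite /copair_fun linearD /= !c0 addr0.
Qed.

(* The Serre functor of the mesh category: [nv v] is the target of a longest
   nonzero path from [v], and [nak X v] is the action of that path. *)
Definition nv (v : vertex) : vertex :=
  match v with
  | (j, L0) => (j, L2)
  | (j, L1) => (j - 1, L1)
  | (j, L2) => (j - 1 - 1, L0)
  end.

Definition nak X (v : vertex) : {linear X v -> X (nv v)} :=
  match v with
  | (j, L0) => rep_map X (a12 j) \o rep_map X (a01 j)
  | (j, L1) => rep_map X (a21 j) \o rep_map X (a12 j)
  | (j, L2) => rep_map X (a10 (j - 1)) \o rep_map X (a21 j)
  end.

Lemma vertex_nv_ind (P : vertex -> Prop) :
  (forall v, P (nv v)) -> forall v, P v.
Proof.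
move=> h [j []]; [have := h (j + 1 + 1, L2)|have := h (j + 1, L1)|
  exact: (h (j, L0))]; by rewrite /= !addrK.
Qed.

Lemma rep_square X j x : rep_map X (a21 j) (rep_map X (a12 j) x) =
  - rep_map X (a01 (j - 1)) (rep_map X (a10 j) x).
Proof. by have /eqP := rep_mesh1 x; rewrite addr_eq0 => /eqP ->; rewrite opprK. Qed.

Lemma rep_square' X j x : rep_map X (a01 (j - 1)) (rep_map X (a10 j) x) =
  - rep_map X (a21 j) (rep_map X (a12 j) x).
Proof. by rewrite rep_square opprK. Qed.

Lemma nak_nat X Y (f : zrep_mor X Y) v x :
  f (nv v) (nak X v x) = nak Y v (f v x).
Proof. by case: v x => j [] x; rewrite /= !rep_nat. Qed.

(** Where needed, the square relation rewrites an arrow followed by a longest path so that one of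
    the zero compositions appears. *)
Lemma nak_kills X v : kills_in (nak X v).
Proof.
move=> u a x; case: u v / a x => j x /=.
- by rewrite rep_square rep_mesh0 linear0 oppr0.
- by rewrite rep_square linearN rep_mesh0 oppr0.
- by rewrite rep_square' linearN rep_mesh2 oppr0.
- by rewrite rep_mesh2 linear0.
Qed.

Lemma nak_dout X m z : nak X (vnext m) (dout X m z) = 0.
Proof. exact: (kills_inP (nak X (vnext m))).1 (@nak_kills X _) z. Qed.

Lemma din_nak X v x : din X (nv v) (nak X v x) = 0.
Proof.
case: v x => j [] x /=; rewrite ?/pair_fun /=.
- by rewrite rep_square rep_mesh0 linear0 oppr0.
- by rewrite rep_mesh2 rep_square linearN rep_mesh0 oppr0.
- by rewrite rep_square' rep_mesh2 linear0 oppr0.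
Qed.

Definition exact_rep X := forall m z, dout X m z = 0 -> exists x, din X m x = z.

Lemma exact_repP X : exact_rep X <-> mesh_exact X.
Proof.
have ker_im (U V W : lmodType R) (f : {linear U -> V}) (g : {linear V -> W}) :
    (forall x, g (f x) = 0) ->
    exact_at f g <-> (forall y, g y = 0 -> exists x, f x = y).
  move=> gf; split=> [fg y gy|fg].
    have : range f y by rewrite fg.
    by case=> x _ <-; exists x.
  apply/seteqP; split=> [_ [x _ <-]|y /fg[x <-]]; first exact: gf.
  by exists x.
have exE j l := ker_im _ _ _ (din X (j, l)) (dout X (j, l)) (@mesh_rel X (j, l)).
split=> [ex j|ex [j []]]; last 3 first.
- by have [e _ _] := ex j; apply: (exE j L0).1.
- by have [_ e _] := ex j; apply: (exE j L1).1.
- by have [_ _ e] := ex j; apply: (exE j L2).1.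
split; [exact: (exE j L0).2 (ex (j, L0))|exact: (exE j L1).2 (ex (j, L1))|].
exact: (exE j L2).2 (ex (j, L2)).
Qed.

Lemma PhiP (A : modCat R -> Prop) X :
  Phi A X <-> (forall m, A (Coker (dout X m))) /\ exact_rep X.
Proof.
rewrite exact_repP; split=> -[h ex]; split=> //.
  by case=> j []; have [h0 h1 h2] := h j => //; have [] := h (j - 1).
move=> j; split; [exact: (h (j, L0))|exact: (h (j, L1))|].
(* The mesh with source [(i, L2)] ends with the arrow [a12 (i - 1)], so the third cokernel of [Phi]
   appears with an index shifted by one. *)
have h2 i : A (Coker (rep_map X (a12 (i - 1)))) by exact: (h (i, L2)).
by have := h2 (j + 1); rewrite addrK.
Qed.

Lemma PsiP (B : modCat R -> Prop) X :
  Psi B X <-> (forall m, B (Ker (din X m))) /\ exact_rep X.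
Proof.
rewrite exact_repP; split=> -[h ex]; split=> //.
  by case=> j []; have [h0 h1 h2] := h j.
Qed.

Section Exact.
Variable X : zrep R.
Hypothesis exX : exact_rep X.

(** Exactness lifts [y] back through the meshes along the longest path; a zero or a signed second
    component turns it into a cycle of the square. *)
Lemma nak_im v y : din X (nv v) y = 0 -> exists x, nak X v x = y.
Proof.
case: v y => j [] y /=; rewrite ?/pair_fun.
- move=> y0; have [|z [z1 z2]] := exX (m := (j, L1)) (z := (0, y)).
    by rewrite /= /copair_fun /= linear0 add0r.
  have [x xE] := exX (m := (j, L0)) z1.
  by exists x; rewrite /= -z2; congr (rep_map X _ _).
- case=> y1 y2; have [w wE] := exX (m := (j, L2)) y2.
  have [x xE] := exX (m := (j - 1, L0)) y1.
  have [|z [z1 z2]] := exX (m := (j, L1)) (z := (- x, w)).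
    rewrite /= /copair_fun /= linearN; move: wE xE => /= -> ->.
    by rewrite addNr.
  by exists z; rewrite /= z2.
- move=> y0; have [|z [z1 z2]] := exX (m := (j - 1, L1)) (z := (y, 0)).
    by rewrite /= /copair_fun /= linear0 addr0.
  have [x xE] := exX (m := (j, L2)) z2.
  by exists x; rewrite /= -z1; congr (rep_map X _ _).
Qed.

(** With [nak_dout], [din_nak] and [nak_im], this makes the longest path induce an isomorphism from
    the cokernel of [dout X m] onto the kernel of [din X (nv (vnext m))]. *)
Lemma nak_ker m x : nak X (vnext m) x = 0 -> exists z, dout X m z = x.
Proof.
case: m x => j [] x /=.
- move=> x0; have [w wE] := exX (m := (j, L2)) x0.
  have [|z [z1 z2]] := exX (m := (j, L1)) (z := (x, - w)).
    by rewrite /= /copair_fun /= linearN; move: wE => /= ->; rewrite subrr.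
  by exists z.
- move=> x0; have [y yE] := nak_im (v := (j - 1, L0)) x0.
  have [|w wE] := exX (m := (j, L2)) (z := x - rep_map X (a01 (j - 1)) y).
    by rewrite /= linearB -yE subrr.
  exists (y, w); rewrite /= /copair_fun /=; move: wE => /= ->.
  by rewrite addrC subrK.
- move=> x0; have [w wE] := exX (m := (j - 1 - 1, L0)) x0.
  have [|z [z1 z2]] := exX (m := (j - 1, L1)) (z := (- w, x)).
    by rewrite /= /copair_fun /= linearN; move: wE => /= ->; rewrite addNr.
  by exists z.
Qed.
End Exact.

End Mesh.

Notation din X := (mesh_in (@rep_map _ X)).
Notation dout X := (mesh_out (@rep_map _ X)).

(** * Short exact sequences of representations, seen at a mesh *)

Section MeshExactSequences.
Variable R : pzRingType.
Variables (X Y Z : zrep R) (i : zrep_mor X Y) (p : zrep_mor Y Z).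
Hypothesis ip : rep_exact i p.

(** A cycle of [X] becomes a boundary [din Y y]. The element [p y] is killed by the arrows of [Z],
    so it comes from a longest path; lifting that path to [Y] corrects [y] to an element of [X]
    without changing its boundary. *)
Lemma exact_rep_ker : exact_rep Y -> exact_rep Z -> exact_rep X.
Proof.
move=> exY exZ; elim/vertex_nv_ind => v z z0.
have mi_inj : injective (mid_map i (nv v)) by case: (mid_exact ip (nv v)).
have mip : mid_map p (nv v) (mid_map i (nv v) z) = 0.
  by case: (mid_exact ip (nv v)) => _ _ ->; exists z.
have [|y yE] := exY _ (mid_map i (nv v) z).
  by rewrite -mid_map_dout z0 linear0.
have [|t tE] := nak_im exZ (y := p _ y); first by rewrite -mid_map_din yE.
have [y' y'E] : exists y', p v y' = t by case: (ip v) => _ + _; apply.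
have [x xE] : exists x, i (nv v) x = y - nak Y v y'.
  have [_ _ <-] := ip (nv v).
  by rewrite linearB nak_nat y'E tE subrr.
by exists x; apply: mi_inj; rewrite mid_map_din xE linearB din_nak subr0.
Qed.

(** A cycle of [Z] lifts to [y] with [dout Y y] coming from some [x] in [X]. The longest path kills
    [x], so [nak_ker] writes [x] as [dout X x'], and subtracting [x'] makes [y] a cycle of [Y]. *)
Lemma exact_rep_coker : exact_rep X -> exact_rep Y -> exact_rep Z.
Proof.
move=> exX exY m z z0; have [_ mp_surj _] := mid_exact ip m.
have [y yE] := mp_surj z; have [_ _ ker_p] := ip (vnext m).
have /ker_p[x xE] : p _ (dout Y m y) = 0 by rewrite mid_map_dout yE.
have [|x' x'E] := nak_ker exX (x := x).
  have [i_inj _ _] := ip (nv (vnext m)); apply: i_inj.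
  by rewrite nak_nat xE linear0; exact: nak_dout.
have [|y' y'E] := exY m (y - mid_map i m x').
  by rewrite linearB -mid_map_dout x'E xE subrr.
exists (p m y'); rewrite -mid_map_din y'E linearB yE.
have -> : mid_map p m (mid_map i m x') = 0.
  by case: (mid_exact ip m) => _ _ ->; exists x'.
by rewrite subr0.
Qed.

(** Cokernels are right exact; the injectivity of [i'] is the part that rests on the exactness of
    the mesh complex of [Z]. *)
Lemma coker_exact m : exact_rep Z ->
  exists (i' : {linear Coker (dout X m) -> Coker (dout Y m)})
    (p' : {linear Coker (dout Y m) -> Coker (dout Z m)}),
  mod_exact i' p' /\
  forall x, i' (coker_proj (dout X m) x) = coker_proj (dout Y m) (i _ x).
Proof.
move=> exZ; have [i_inj p_surj ker_p] := ip (vnext m).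
have [mi_inj mp_surj ker_mp] := mid_exact ip m.
pose cX := coker_proj (dout X m); pose cY := coker_proj (dout Y m).
pose cZ := coker_proj (dout Z m).
have iY x : cX x = 0 -> (cY \o i (vnext m)) x = 0.
  move=> /coker_proj_eq0[z _ <-]; apply/coker_proj_eq0.
  by exists (mid_map i m z) => //; rewrite -mid_map_dout.
have pZ y : cY y = 0 -> (cZ \o p (vnext m)) y = 0.
  move=> /coker_proj_eq0[z _ <-]; apply/coker_proj_eq0.
  by exists (mid_map p m z) => //; rewrite -mid_map_dout.
pose i' := lin_desc (coker_proj_surj (f := dout X m)) iY.
pose p' := lin_desc (coker_proj_surj (f := dout Y m)) pZ.
have i'E x : i' (cX x) = cY (i _ x) by apply: lin_descE.
have p'E y : p' (cY y) = cZ (p _ y) by apply: lin_descE.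
have cokI : injective i'.
  apply: ker0_inj => u; have [x <-] := coker_proj_surj u.
  rewrite i'E => /coker_proj_eq0[z _ zE].
  have [|t tE] := exZ m (mid_map p m z).
    by rewrite -mid_map_dout zE; apply/ker_p; exists x.
  have [y yE] : exists y, p m y = t by case: (ip m) => _ + _; apply.
  have /ker_mp[w wE] : mid_map p m (z - din Y m y) = 0.
    by rewrite linearB mid_map_din yE tE subrr.
  apply/coker_proj_eq0; exists w => //; apply: i_inj.
  by rewrite mid_map_dout wE linearB mesh_rel subr0.
exists i', p'; split=> //; split=> [|w|q].
- exact: cokI.
- have [z <-] := coker_proj_surj w; have [y <-] := p_surj z.
  by exists (cY y).
- have [y <-] := coker_proj_surj q; rewrite p'E coker_proj_eq0.
  split=> [[z _ zE]|[u]].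
    have [y' y'E] := mp_surj z.
    have /ker_p[x xE] : p (vnext m) (y - dout Y m y') = 0.
      by rewrite linearB mid_map_dout y'E zE subrr.
    exists (cX x); rewrite i'E xE linearB.
    by rewrite (_ : cY (dout Y m y') = 0) ?subr0 //; apply/coker_proj_eq0; exists y'.
  have [x <-] := coker_proj_surj u; rewrite i'E => xy.
  have /coker_proj_eq0[z _ zE] : cY (y - i (vnext m) x) = 0.
    by rewrite linearB xy subrr.
  exists (mid_map p m z) => //; rewrite -mid_map_dout zE linearB.
  by rewrite (_ : p _ (i _ x) = 0) ?subr0 //; apply/ker_p; exists x.
Qed.

(** Kernels are left exact; the surjectivity of [p'] is the part that rests on the exactness of the
    mesh complex of [X]. *)
Lemma ker_exact m : exact_rep X ->
  exists (i' : {linear Ker (din X m) -> Ker (din Y m)})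
    (p' : {linear Ker (din Y m) -> Ker (din Z m)}),
  mod_exact i' p' /\
  forall y, ker_incl (din Z m) (p' y) = p _ (ker_incl (din Y m) y).
Proof.
move=> exX; have [i_inj p_surj ker_p] := ip m.
have [mi_inj mp_surj ker_mp] := mid_exact ip m.
pose kX := ker_incl (din X m); pose kY := ker_incl (din Y m).
pose kZ := ker_incl (din Z m).
have din_k (T : zrep R) k : din T m (ker_incl (din T m) k) = 0.
  by apply/ker_inclP; exists k.
have kY_inj : injective kY by apply: ker_incl_inj.
have kZ_inj : injective kZ by apply: ker_incl_inj.
have iY x : exists k, kY k = (i m \o kX) x.
  have /ker_inclP[k _ kE] : din Y m (i m (kX x)) = 0.
    by rewrite -mid_map_din din_k linear0.
  by exists k.
have pZ y : exists k, kZ k = (p m \o kY) y.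
  have /ker_inclP[k _ kE] : din Z m (p m (kY y)) = 0.
    by rewrite -mid_map_din din_k linear0.
  by exists k.
pose i' := lin_lift kY_inj iY; pose p' := lin_lift kZ_inj pZ.
have i'E x : kY (i' x) = i m (kX x) by apply: lin_liftE.
have p'E y : kZ (p' y) = p m (kY y) by apply: lin_liftE.
exists i', p'; split=> //; split=> [x x' /(congr1 kY)|t|q].
- by rewrite !i'E => /i_inj/ker_incl_inj.
- have [y yE] := p_surj (kZ t).
  have /ker_mp[z zE] : mid_map p m (din Y m y) = 0.
    by rewrite mid_map_din yE din_k.
  have [|x xE] := exX m z.
    have [it_inj _ _] := ip (vnext m).
    by apply: it_inj; rewrite mid_map_dout zE mesh_rel linear0.
  have /ker_inclP[k _ kE] : din Y m (y - i m x) = 0.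
    by rewrite linearB -mid_map_din xE zE subrr.
  exists k; apply: (kZ_inj); rewrite p'E [kY k]kE linearB yE.
  by rewrite (_ : p m (i m x) = 0) ?subr0 //; apply/ker_p; exists x.
- split=> [/(congr1 kZ)|[x <-]].
    rewrite p'E linear0 => /ker_p[x xE].
    have /ker_inclP[k _ kE] : din X m x = 0.
      by apply: mi_inj; rewrite mid_map_din xE din_k linear0.
    by exists k; apply: (kY_inj); rewrite i'E -xE -kE.
  apply: (kZ_inj); rewrite p'E i'E linear0.
  by apply/ker_p; exists (kX x).
Qed.
End MeshExactSequences.

(** * Extensions with representations whose arrows are zero *)

Section NullRepresentations.
Variable R : pzRingType.
Implicit Types (S T : vertex -> lmodType R) (X Y Z E : zrep R).

Definition null_rep X := forall u v (a : zarrow u v) x, rep_map X a x = 0.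

Definition triv T : zrep R.
Proof. by exists T (fun u v a => \0) => j x /=; rewrite ?addr0. Defined.

Definition triv_map S T (f : forall v, {linear S v -> T v}) :
  zrep_mor (triv S) (triv T).
Proof. by exists f => u v a x /=; rewrite linear0. Defined.

Definition to_triv X T (f : forall v, {linear X v -> T v})
  (f_kills : forall v, kills_in (f v)) : zrep_mor X (triv T).
Proof. by exists f => u v a x /=; apply: f_kills. Defined.

Definition from_triv T X (f : forall v, {linear T v -> X v})
  (f_killed : forall v t, din X v (f v t) = 0) : zrep_mor (triv T) X.
Proof.
exists f => u v a x /=; rewrite linear0; apply/esym.
by move: (f_killed u x) => /din_eq0; apply.
Defined.

Lemma null_dout X m z : null_rep X -> dout X m z = 0.
Proof.
by move=> X0; case: m z => j [] z; rewrite /= ?X0 // /copair_fun !X0 addr0.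
Qed.

Lemma null_din X m x : null_rep X -> din X m x = 0.
Proof. by move=> X0; apply/din_eq0 => w a; apply: X0. Qed.

(** By [coker_exact] the extension stays exact on the cokernels of the incoming arrows and is
    retracted there. Pulled back to [E], these retractions kill the incoming arrows, which is all
    that naturality demands for a target with zero arrows. *)
Lemma Ext1_null_r X (T : zrep R) : exact_rep X -> null_rep T ->
  (forall m, Ext1_zero (C := modCat R) (Coker (dout X m)) (T (vnext m))) ->
  Ext1_zero (C := repCat R) X T.
Proof.
move=> exX T0 extT; apply/rep_Ext1_retr => E i p ip.
have retr v : exists r : {linear E v -> T v},
    (forall t, r (i v t) = t) /\ kills_in r.
  elim/vertex_next_ind: v => m.
  have [i' [p' [ex i'E]]] := coker_exact ip m exX.
  pose c := coker_proj (dout T m).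
  (* Since [dout T m] is zero, the identity of [T (vnext m)] descends to its cokernel. *)
  have c0 t : c t = 0 -> (idfun : {linear T (vnext m) -> T (vnext m)}) t = 0.
    by move=> /coker_proj_eq0[z _ <-]; apply: null_dout.
  have [h hE] := mod_extend (extT m) (lin_desc (coker_proj_surj (f := dout T m)) c0) ex.
  exists (h \o coker_proj (dout E m)); split=> [t|].
    by rewrite /= -i'E hE lin_descE.
  apply/kills_inP => z; rewrite /= (_ : coker_proj _ _ = 0) ?linear0 //.
  by apply/coker_proj_eq0; exists z.
pose r v := projT1 (cid (retr v)).
have rP v : (forall t, r v (i v t) = t) /\ kills_in (r v) := projT2 (cid (retr v)).
have rN u v (a : zarrow u v) x : r v (rep_map E a x) = rep_map T a (r u x).
  by rewrite T0 (rP v).2.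
by exists (ZRepMor rN) => v; exact: (rP v).1.
Qed.

(** Dual to [Ext1_null_r]: the sections found on the kernels of the outgoing arrows are
    automatically natural. *)
Lemma Ext1_null_l (T : zrep R) X : exact_rep X -> null_rep T ->
  (forall m, Ext1_zero (C := modCat R) (T m) (Ker (din X m))) ->
  Ext1_zero (C := repCat R) T X.
Proof.
move=> exX T0 extT; apply/rep_Ext1P => E i p ip.
have sect m : exists s : {linear T m -> E m},
    (forall t, p m (s t) = t) /\ forall t, din E m (s t) = 0.
  have [i' [p' [ex p'E]]] := ker_exact ip m exX.
  have c0 t : exists k, ker_incl (din T m) k = (idfun : {linear T m -> T m}) t.
    by have /ker_inclP[k _ kE] := null_din t T0; exists k.
  have [h hE] := mod_lift (extT m) (lin_lift (@ker_incl_inj _ _ _ (din T m)) c0) ex.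
  exists (ker_incl (din E m) \o h); split=> t.
    by rewrite /= -[p m _]p'E hE lin_liftE.
  by apply/ker_inclP; exists (h t).
pose s v := projT1 (cid (sect v)).
have sP v : (forall t, p v (s v t) = t) /\ (forall t, din E v (s v t) = 0)
  := projT2 (cid (sect v)).
have sN u v (a : zarrow u v) x : s v (rep_map T a x) = rep_map E a (s u x).
  by rewrite T0 linear0; apply/esym; move: ((sP u).2 x) => /din_eq0; apply.
by exists (ZRepMor sN) => v; exact: (sP v).1.
Qed.

(* Vanishing of Ext at one vertex is deduced from vanishing for representations
   by completing the given extension with split ones at the other vertices. *)
Section UpdateFamily.
Variables (D : vertex -> Type) (d : forall v, D v) (v0 : vertex) (d0 : D v0).

Definition upd v : D v :=
  match pselect (v0 = v) with
  | left e => eq_rect v0 D d0 v e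
  | right _ => d v
  end.

Lemma upd_in : upd v0 = d0.
Proof.
by rewrite /upd; case: pselect => // e; rewrite (Prop_irrelevance e erefl).
Qed.
End UpdateFamily.

Lemma prod_exact (U V : lmodType R) :
  mod_exact (pair_lin idfun \0 : {linear U -> (U * V)%type})
    (snd : {linear (U * V)%type -> V}).
Proof.
split=> [x y [] //|v|[u v]]; first by exists (0, v).
by split=> [/= ->|[w [_ <-]]] //; exists u.
Qed.

(** The projection onto the cokernel is part of a morphism from [X] to a null representation. It
    lifts along the completed extension, and the lift kills the incoming arrows, so it descends to a
    section. *)
Lemma Coker_Ext1 X m (B : lmodType R) :
  Ext1_zero (C := repCat R) X (triv (fun=> B)) ->
  Ext1_zero (C := modCat R) (Coker (dout X m)) B.
Proof.
move=> extX; apply/mod_Ext1P => E0 i0 p0 ip0.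
pose P v (E C : lmodType R) (i : {linear B -> E}) (p : {linear E -> C})
  (c : {linear X v -> C}) := mod_exact i p /\ kills_in c.
(* The data at a vertex are packed into one type, so that [upd] replaces them together and [upd_in]
   rewrites the packed datum without transport. *)
pose D v := {E : lmodType R & {C : lmodType R & {i : {linear B -> E} &
  {p : {linear E -> C} & {c : {linear X v -> C} | P v E C i p c}}}}}.
have dflt_P v : P v (B * B)%type B (pair_lin idfun \0) snd \0.
  by split=> //; apply: prod_exact.
pose dflt v : D v := existT _ _ (existT _ _ (existT _ _ (existT _ _ (exist _ _ (dflt_P v))))).
have P0 : P (vnext m) E0 (Coker (dout X m)) i0 p0 (coker_proj (dout X m)).
  by split=> //; apply/kills_inP => z; apply/coker_proj_eq0; exists z.
pose d0 : D (vnext m) :=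
  existT _ _ (existT _ _ (existT _ _ (existT _ _ (exist _ _ P0)))).
pose d := upd dflt d0.
pose Ev v : lmodType R := projT1 (d v).
pose Cv v : lmodType R := projT1 (projT2 (d v)).
pose iv v : {linear B -> Ev v} := projT1 (projT2 (projT2 (d v))).
pose pv v : {linear Ev v -> Cv v} := projT1 (projT2 (projT2 (projT2 (d v)))).
pose cv v : {linear X v -> Cv v} := sval (projT2 (projT2 (projT2 (projT2 (d v))))).
have dP v : P v (Ev v) (Cv v) (iv v) (pv v) (cv v) :=
  svalP (projT2 (projT2 (projT2 (projT2 (d v))))).
have c_kills v : kills_in (cv v) := (dP v).2.
have ex : rep_exact (triv_map iv) (triv_map pv) by move=> v; exact: (dP v).1.
have [h hE] := rep_lift extX (to_triv c_kills) ex.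
pose Q v (x : D v) := exists h : {linear X v -> projT1 x},
  (forall y, projT1 (projT2 (projT2 (projT2 x))) (h y) =
     sval (projT2 (projT2 (projT2 (projT2 x)))) y) /\ kills_in h.
have : Q (vnext m) (d (vnext m)).
  exists (h (vnext m)); split=> [y|u a x]; first exact: hE.
  by rewrite rep_nat.
rewrite /d upd_in => -[g [/= pg /kills_inP g_kills]].
have g0 y : coker_proj (dout X m) y = 0 -> g y = 0.
  by move=> /coker_proj_eq0[z _ <-].
exists (lin_desc (coker_proj_surj (f := dout X m)) g0) => x.
by have [y <-] := coker_proj_surj x; rewrite lin_descE pg.
Qed.

(** Dual to [Coker_Ext1]: the inclusion of the kernel extends to the middle term, with image still
    killed by the outgoing arrows. *)
Lemma Ker_Ext1 X m (A : lmodType R) :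
  Ext1_zero (C := repCat R) (triv (fun=> A)) X ->
  Ext1_zero (C := modCat R) A (Ker (din X m)).
Proof.
move=> extX; apply/mod_Ext1_retr => E0 i0 p0 ip0.
pose P v (E C : lmodType R) (i : {linear C -> E}) (p : {linear E -> A})
  (c : {linear C -> X v}) := mod_exact i p /\ forall t, din X v (c t) = 0.
pose D v := {E : lmodType R & {C : lmodType R & {i : {linear C -> E} &
  {p : {linear E -> A} & {c : {linear C -> X v} | P v E C i p c}}}}}.
have dflt_P v : P v (A * A)%type A (pair_lin idfun \0) snd \0.
  by split=> [|t]; [apply: prod_exact | rewrite /= linear0].
pose dflt v : D v := existT _ _ (existT _ _ (existT _ _ (existT _ _ (exist _ _ (dflt_P v))))).
have P0 : P m E0 (Ker (din X m)) i0 p0 (ker_incl (din X m)).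
  by split=> // z; apply/ker_inclP; exists z.
pose d0 : D m :=
  existT _ _ (existT _ _ (existT _ _ (existT _ _ (exist _ _ P0)))).
pose d := upd dflt d0.
pose Ev v : lmodType R := projT1 (d v).
pose Cv v : lmodType R := projT1 (projT2 (d v)).
pose iv v : {linear Cv v -> Ev v} := projT1 (projT2 (projT2 (d v))).
pose pv v : {linear Ev v -> A} := projT1 (projT2 (projT2 (projT2 (d v)))).
pose cv v : {linear Cv v -> X v} := sval (projT2 (projT2 (projT2 (projT2 (d v))))).
have dP v : P v (Ev v) (Cv v) (iv v) (pv v) (cv v) :=
  svalP (projT2 (projT2 (projT2 (projT2 (d v))))).
have c_killed v : forall t, din X v (cv v t) = 0 := (dP v).2.
have ex : rep_exact (triv_map iv) (triv_map pv) by move=> v; exact: (dP v).1.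
have [h hE] := rep_extend extX (from_triv c_killed) ex.
pose Q v (x : D v) := exists h : {linear projT1 x -> X v},
  (forall y, h (projT1 (projT2 (projT2 x)) y) =
     sval (projT2 (projT2 (projT2 (projT2 x)))) y) /\
  forall t, din X v (h t) = 0.
have : Q m (d m).
  exists (h m); split=> [y|t]; first exact: hE.
  apply/din_eq0 => w a; rewrite -[LHS](rep_nat h a) /=.
  exact: linear0.
rewrite /d upd_in => -[g [/= pg g_killed]].
have g0 y : exists k, ker_incl (din X m) k = g y.
  by have /ker_inclP[k _ kE] := g_killed y; exists k.
exists (lin_lift (@ker_incl_inj _ _ _ (din X m)) g0) => x.
by apply: (@ker_incl_inj _ _ _ (din X m)); rewrite lin_liftE pg.
Qed.

Section ShiftFamily.
Variables (D : int -> Type) (d : forall j : int, D (j - 1)).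

(** Extends a family known at the indices [j - 1] to all indices, by transport along
    [j + 1 - 1 = j]. *)
Definition shift_fam j : D j := eq_rect _ D (d (j + 1)) _ (addrK 1 j).

Lemma shift_famE j : shift_fam (j - 1) = d j.
Proof.
rewrite /shift_fam; move: (addrK 1 (j - 1)).
have gen i (e : i - 1 = j - 1) : eq_rect _ D (d i) _ e = d j.
  by have ij := @addIr int (- 1) _ _ e; subst i; rewrite (Prop_irrelevance e erefl).
exact: gen.
Qed.
End ShiftFamily.

(** Each arrow is a component of exactly one [mesh_out], so these components can be prescribed
    freely. The arrows [a01] and [a12] occur there with index [j - 1], hence [shift_fam]. *)
Lemma mesh_out_split S T (f : forall m, {linear Mid S m -> T (vnext m)}) :
  exists a : arrows S T, forall m z, mesh_out a m z = f m z.
Proof.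
pose b01 := shift_fam (D := fun j => {linear S (j, L0) -> T (j, L1)})
  (fun j => f (j, L1) \o (pair_lin idfun \0 :
     {linear S (j - 1, L0) -> (S (j - 1, L0) * S (j, L2))%type})).
pose b12 := shift_fam (D := fun j => {linear S (j, L1) -> T (j, L2)})
  (fun j => f (j, L2)).
pose b21 j : {linear S (j, L2) -> T (j - 1, L1)} :=
  f (j, L1) \o (pair_lin \0 idfun :
     {linear S (j, L2) -> (S (j - 1, L0) * S (j, L2))%type}).
exists (fun u v a =>
  match a in zarrow u v return {linear S u -> T v} with
  | a01 j => b01 j | a12 j => b12 j | a10 j => f (j, L0) | a21 j => b21 j
  end) => -[j []] z //=; last by rewrite /b12 shift_famE.
rewrite /copair_fun /b01 shift_famE /= -linearD.
by case: z => x y; congr (f _ _); congr pair; rewrite /= ?addr0 ?add0r.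
Qed.

Lemma mesh_in_split S T (f : forall m, {linear S m -> Mid T m}) :
  exists a : arrows S T, forall m z, mesh_in a m z = f m z.
Proof.
exists (fun u v a =>
  match a in zarrow u v return {linear S u -> T v} with
  | a01 j => f (j, L0) | a12 j => snd \o f (j, L1) | a10 j => fst \o f (j, L1)
  | a21 j => f (j, L2)
  end) => -[j []] z //=.
by rewrite /pair_fun /=; case: (f _ z).
Qed.

(* A family of functionals killing the image of [din X] is a cocycle, and the
   extension it defines splits only if the functionals factor through
   [dout X]. *)
Lemma null_extension_r X T (f : forall m, {linear Mid X m -> T (vnext m)}) :
  (forall m x, f m (din X m x) = 0) -> Ext1_zero (C := repCat R) X (triv T) ->
  forall m z, dout X m z = 0 -> f m z = 0.
Proof.
move=> f_din /rep_Ext1P ext0; have [a aE] := mesh_out_split f.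
(* The cocycle [a] is the off-diagonal block of the arrows of the extension; the mesh relations hold
   because [f] kills the image of [din X]. *)
pose Ea : arrows (fun v => T v * X v)%type (fun v => T v * X v)%type :=
  fun u v b => pair_lin (a u v b \o snd) (rep_map X b \o snd).
have Erel m x : mesh_out Ea m (mesh_in Ea m x) = 0.
  have := f_din m x.2; have := mesh_rel x.2; rewrite -aE.
  case: m x => j [] x /=; rewrite /pair_fun /= => r1 r2; congr pair => //.
pose E := mesh_rep Erel.
have iN u v (b : zarrow u v) x :
  pair_lin idfun \0 (rep_map (triv T) b x) = rep_map E b (pair_lin idfun \0 x).
  by rewrite /= /pair_fun /= !linear0.
pose i : zrep_mor (triv T) E := @ZRepMor _ (triv T) E (fun v => pair_lin idfun \0) iN.
have pN u v (b : zarrow u v) (x : E u) : (rep_map E b x).2 = rep_map X b x.2.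
  by [].
pose p : zrep_mor E X :=
  @ZRepMor _ E X (fun v => snd : {linear (T v * X v)%type -> X v}) pN.
have [s sE] : exists s : zrep_mor X E, forall v x, p v (s v x) = x.
  by apply: (ext0 E i p) => v; apply: prod_exact.
(* The arrows of [E] vanish on [T], so the first component of the section exhibits [a] as a
   coboundary. *)
have sa u v (b : zarrow u v) x : (s v (rep_map X b x)).1 = a u v b x.
  by rewrite rep_nat /= [(s u x).2]sE.
move=> m z z0; rewrite -aE -[RHS]/((0 : T (vnext m) * X (vnext m))%type.1).
rewrite -[X in X.1](linear0 (s (vnext m))) -z0.
case: m z z0 => j [] z z0 /=; rewrite ?sa //.
by rewrite /copair_fun linearD /= !sa.
Qed.

(** Dual to [null_extension_r]: the cocycle now maps [T] into [X]. A splitting yields elements of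
    [X] whose images under the arrows are the values of the cocycle up to sign, so [f] lands in the
    image of [din X]. *)
Lemma null_extension_l X T (f : forall m, {linear T m -> Mid X m}) :
  (forall m x, dout X m (f m x) = 0) -> Ext1_zero (C := repCat R) (triv T) X ->
  forall m t, exists x, din X m x = f m t.
Proof.
move=> f_dout /rep_Ext1P ext0; have [a aE] := mesh_in_split f.
pose Ea : arrows (fun v => X v * T v)%type (fun v => X v * T v)%type :=
  fun u v b => pair_lin (copair_lin (rep_map X b) (a u v b)) \0.
have Erel m x : mesh_out Ea m (mesh_in Ea m x) = 0.
  have := f_dout m x.2; have := mesh_rel x.1; rewrite -aE.
  case: m x => j [] x /=; rewrite /pair_fun /= /copair_fun /= ?linear0 ?addr0;
    move=> r1 r2; congr pair; rewrite /= ?/copair_fun /= ?linear0 ?addr0 //.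
  - by rewrite linearD r1 r2 addr0.
  - by rewrite !linearD addrACA r1 r2 addr0.
  - by rewrite linearD r1 r2 addr0.
pose E := mesh_rep Erel.
have iN u v (b : zarrow u v) x :
  pair_lin idfun \0 (rep_map X b x) = rep_map E b (pair_lin idfun \0 x).
  by rewrite /= /pair_fun /= /copair_fun /= linear0 addr0.
pose i : zrep_mor X E := @ZRepMor _ X E (fun v => pair_lin idfun \0) iN.
have pN u v (b : zarrow u v) (x : E u) : (rep_map E b x).2 = rep_map (triv T) b x.2.
  by [].
pose p : zrep_mor E (triv T) :=
  @ZRepMor _ E (triv T) (fun v => snd : {linear (X v * T v)%type -> T v}) pN.
have [s sE] : exists s : zrep_mor (triv T) E, forall v x, p v (s v x) = x.
  by apply: (ext0 E i p) => v; apply: prod_exact.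
have sa u v (b : zarrow u v) t : rep_map X b (s u t).1 = - a u v b t.
  have /(congr1 fst) := rep_nat s b t; rewrite linear0 /= /copair_fun.
  rewrite [(s u t).2]sE => /esym/eqP; rewrite addr_eq0 => /eqP //.
move=> m t; exists (- (s m t).1); rewrite linearN -aE.
case: m t => j [] t /=; rewrite /pair_fun ?sa ?opprK //.
by congr pair; rewrite /= opprK.
Qed.

End NullRepresentations.

Ltac pair_simpl := rewrite /=; repeat (progress rewrite /pair_fun /copair_fun /=).

(** * Free and cofree representations generated by a family of modules *)

Section Contractible.
Variable R : pzRingType.
Implicit Types (S T M N : vertex -> lmodType R) (X Y Z E : zrep R).

Section Cast.
Variable T : int -> lmodType R.

Definition lcast i j (e : i = j) : {linear T i -> T j} :=
  match e in _ = k return {linear T i -> T k} with erefl => idfun end.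

Definition shi j : {linear T j -> T (j - 1 + 1)} := lcast (esym (subrK 1 j)).
Definition shi_inv j : {linear T (j - 1 + 1) -> T j} := lcast (subrK 1 j).

Lemma lcastK i j (e : i = j) (e' : j = i) x : lcast e' (lcast e x) = x.
Proof. by subst j; rewrite (Prop_irrelevance e' erefl). Qed.

Lemma shiK j x : shi_inv j (shi j x) = x. Proof. exact: lcastK. Qed.
Lemma shi_invK j x : shi j (shi_inv j x) = x. Proof. exact: lcastK. Qed.
Lemma shi_inj j : injective (shi j). Proof. exact: can_inj (@shiK j). Qed.

Lemma shi_eq0 j x : shi j x = 0 -> x = 0.
Proof. by rewrite -{1}(linear0 (shi j)) => /shi_inj. Qed.
End Cast.

Lemma shi_nat (S T : int -> lmodType R) (f : forall j, {linear S j -> T j}) j x :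
  f (j - 1 + 1) (shi S j x) = shi T j (f j x).
Proof.
rewrite /shi; move: (esym _); move: (j - 1 + 1) => i e.
by subst i.
Qed.

Lemma int_next_ind (P : int -> Prop) : (forall j, P (j - 1)) -> forall j, P j.
Proof. by move=> h j; have := h (j + 1); rewrite addrK. Qed.

Section Cofree.
Variable M : vertex -> lmodType R.

(* the product of the [M w], one factor for each nonzero path starting at [v],
   the trivial path coming first and the path to [nv v] last *)
Definition cofree_obj (v : vertex) : lmodType R :=
  match v with
  | (j, L0) => (M (j, L0) * (M (j, L1) * M (j, L2)))%type
  | (j, L1) => ((M (j, L1) * M (j - 1, L0)) * (M (j, L2) * M (j - 1, L1)))%type
  | (j, L2) => (M (j, L2) * (M (j - 1, L1) * M (j - 1 - 1, L0)))%type
  end.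

(** An arrow keeps the factors of the paths that begin with it. The sign in [a12] makes the squares
    anticommute. *)
Definition cofree_arrow : arrows cofree_obj cofree_obj := fun u v a =>
  match a in zarrow u v return {linear cofree_obj u -> cofree_obj v} with
  | a01 j => pair_lin (pair_lin (fst \o snd) \0) (pair_lin (snd \o snd) \0)
  | a12 j => pair_lin (fst \o snd) (pair_lin (\- (snd \o snd)) \0)
  | a10 j => pair_lin (snd \o fst) (pair_lin (snd \o snd) \0)
  | a21 j => pair_lin snd \0
  end.

Definition cofree : zrep R.
Proof.
exists cofree_obj cofree_arrow => j x /=; rewrite /pair_fun /=.
- by [].
- by congr pair; congr pair; rewrite /= ?subrr ?addr0.
- by rewrite /pair_fun /= oppr0.
Defined.

Definition cofree_pr v : {linear cofree v -> M v} :=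
  match v with
  | (j, L0) => fst
  | (j, L1) => fst \o fst
  | (j, L2) => fst
  end.

Section UniversalProperty.
Variables (X : zrep R) (f : forall v, {linear X v -> M v}).

Definition cofree_lift_fun v : {linear X v -> cofree v} :=
  match v with
  | (j, L0) => pair_lin (f (j, L0)) (pair_lin (f (j, L1) \o rep_map X (a01 j))
      (f (j, L2) \o (rep_map X (a12 j) \o rep_map X (a01 j))))
  | (j, L1) =>
    pair_lin (pair_lin (f (j, L1)) (f (j - 1, L0) \o rep_map X (a10 j)))
      (pair_lin (f (j, L2) \o rep_map X (a12 j))
         (f (j - 1, L1) \o (rep_map X (a01 (j - 1)) \o rep_map X (a10 j))))
  | (j, L2) => pair_lin (f (j, L2)) (pair_lin (f (j - 1, L1) \o rep_map X (a21 j))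
      (f (j - 1 - 1, L0) \o (rep_map X (a10 (j - 1)) \o rep_map X (a21 j))))
  end.

Definition cofree_lift : zrep_mor X cofree.
Proof.
exists cofree_lift_fun => u v a x; case: u v / a x => j x; pair_simpl.
- by rewrite rep_mesh0 !linear0.
- by rewrite rep_square !linearN /= rep_mesh0 !linear0.
- by rewrite rep_square' !linearN /= rep_mesh2 !linear0.
- by rewrite rep_square' !rep_mesh2 !linear0.
Defined.

Lemma cofree_liftE v x : cofree_pr v (cofree_lift v x) = f v x.
Proof. by case: v x => j []. Qed.
End UniversalProperty.

(** Up to sign, each component of [d v x] is [cofree_pr] of [d] at the image of [x] under a path. *)
Lemma cofree_mor0 X (d : zrep_mor X cofree) :
  (forall v x, cofree_pr v (d v x) = 0) -> forall v x, d v x = 0.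
Proof.
move=> d0 [j []] x.
- have := d0 _ (rep_map X (a12 j) (rep_map X (a01 j) x)).
  have := d0 _ (rep_map X (a01 j) x); have := d0 _ x.
  rewrite !rep_nat; case: (d (j, L0) x) => y [z t] /=; rewrite /pair_fun /=.
  by move=> -> -> ->.
- have := d0 _ (rep_map X (a01 (j - 1)) (rep_map X (a10 j) x)).
  have := d0 _ (rep_map X (a12 j) x).
  have := d0 _ (rep_map X (a10 j) x); have := d0 _ x.
  rewrite !rep_nat; case: (d (j, L1) x) => -[y y'] [z z'] /=; rewrite /pair_fun /=.
  by move=> -> -> -> ->.
- have := d0 _ (rep_map X (a10 (j - 1)) (rep_map X (a21 j) x)).
  have := d0 _ (rep_map X (a21 j) x); have := d0 _ x.
  rewrite !rep_nat; case: (d (j, L2) x) => y [z t] /=; rewrite /pair_fun /=.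
  by move=> -> -> ->.
Qed.

Lemma cofree_exact : exact_rep cofree.
Proof.
case=> j [] z; pair_simpl.
- case: z => -[x y] [z w] /= [-> ->].
  by exists (0, (x, z)).
- case: z => -[x [y z]] [x' [y' z']] /= [].
  move=> /eqP; rewrite addr_eq0 => /eqP -> + /eqP; rewrite add0r addr0 => -> /eqP ->.
  by exists ((0, x), (x', - y')); pair_simpl; rewrite opprK.
- case: z => -[x y] [z w] /= [-> /eqP]; rewrite oppr_eq0 => /eqP ->.
  by exists (0, (x, y)).
Qed.

(** Up to sign, this is the projection to the factor of the path to [nv v]. *)
Definition cofree_last v : {linear cofree v -> M (nv v)} :=
  cofree_pr (nv v) \o nak cofree v.

Lemma cofree_lastE v x :
  cofree_last v x = cofree_pr (nv v) (nak cofree v x).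
Proof. by []. Qed.

Lemma cofree_last_surj v y : exists x, cofree_last v x = y.
Proof.
case: v y => j [] y; rewrite /cofree_last; pair_simpl.
- by exists (0, (0, y)).
- by exists ((0, 0), (0, - y)); rewrite /= opprK.
- by exists (0, (0, y)).
Qed.

(** All other factors are reached by incoming arrows, so the cokernel of these arrows is the last
    factor. *)
Lemma cofree_last_ker m x :
  cofree_last (vnext m) x = 0 -> exists z, dout cofree m z = x.
Proof.
case: m x => j [] x; rewrite /cofree_last; pair_simpl.
- case: x => x [y z] /= ->; exists ((0, x), (0, y)).
  by [].
- case: x => -[x y] [z w] /= /eqP; rewrite oppr_eq0 => /eqP ->.
  exists ((0, (x, z)), (0, (0, y))); pair_simpl.
  by congr pair; congr pair; rewrite /= ?addr0 ?add0r.
- case: x => x [y z] /= ->; exists ((0, 0), (x, - y)).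
  by pair_simpl; rewrite opprK.
Qed.

(** The part killed by all outgoing arrows is the factor of the trivial path. *)
Lemma cofree_socle v : exists i : {linear M v -> cofree v},
  (forall x, din cofree v (i x) = 0) /\
  forall y, din cofree v y = 0 -> y = i (cofree_pr v y).
Proof.
exists (match v return {linear M v -> cofree v} with
  | (j, L0) => pair_lin idfun \0
  | (j, L1) => pair_lin (pair_lin idfun \0) \0
  | (j, L2) => pair_lin idfun \0 end).
split; case: v => j [] x; pair_simpl => //; first by rewrite oppr0.
- by case: x => x [y z] /= [-> ->].
- by case: x => -[x y] [z w] /= [-> -> ->].
- by case: x => x [y z] /= [-> ->].
Qed.
End Cofree.

Section CofreeMap.
Variables S T T' : vertex -> lmodType R.

Definition cofree_map_fun (f : forall v, {linear S v -> T v}) v :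
    {linear cofree S v -> cofree T v} :=
  match v with
  | (j, L0) => prod_map (f _) (prod_map (f _) (f _))
  | (j, L1) => prod_map (prod_map (f _) (f _)) (prod_map (f _) (f _))
  | (j, L2) => prod_map (f _) (prod_map (f _) (f _))
  end.

Definition cofree_map (f : forall v, {linear S v -> T v}) : zrep_mor (cofree S) (cofree T).
Proof.
exists (cofree_map_fun f) => u v a x; case: u v / a x => j x; pair_simpl;
  rewrite ?linear0 //.
by rewrite linearN.
Defined.

Lemma cofree_map_pr (f : forall v, {linear S v -> T v}) v x :
  cofree_pr T v (cofree_map f v x) = f v (cofree_pr S v x).
Proof. by case: v x => j []. Qed.
End CofreeMap.

Lemma cofree_map_exact S T T' (f : forall v, {linear S v -> T v})
    (g : forall v, {linear T v -> T' v}) :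
  (forall v, mod_exact (f v) (g v)) ->
  rep_exact (cofree_map f) (cofree_map g).
Proof. by move=> fg [j []]; do ![apply: prod_map_exact]. Qed.

Section Free.
Variable M : vertex -> lmodType R.

(** Naming the modules at shifted indices confines the transports along [j - 1 + 1 = j] to [s1],
    [s2], [s22] and their inverses. *)
Definition next1 (j : int) : lmodType R := M (j + 1, L1).
Definition next2 (j : int) : lmodType R := M (j + 1, L2).
Definition next22 (j : int) : lmodType R := next2 (j + 1).

Definition s1 j : {linear M (j, L1) -> next1 (j - 1)} :=
  shi (fun j => M (j, L1)) j.
Definition s2 j : {linear M (j, L2) -> next2 (j - 1)} :=
  shi (fun j => M (j, L2)) j.
Definition s22 j : {linear next2 j -> next22 (j - 1)} := shi next2 j.

Definition t1 j : {linear next1 (j - 1) -> M (j, L1)} :=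
  shi_inv (fun j => M (j, L1)) j.
Definition t2 j : {linear next2 (j - 1) -> M (j, L2)} :=
  shi_inv (fun j => M (j, L2)) j.
Definition t22 j : {linear next22 (j - 1) -> next2 j} := shi_inv next2 j.

Lemma s1K j x : s1 j (t1 j x) = x. Proof. exact: shi_invK. Qed.
Lemma s2K j x : s2 j (t2 j x) = x. Proof. exact: shi_invK. Qed.
Lemma s22K j x : s22 j (t22 j x) = x. Proof. exact: shi_invK. Qed.
Lemma t1K j x : t1 j (s1 j x) = x. Proof. exact: shiK. Qed.
Lemma t2K j x : t2 j (s2 j x) = x. Proof. exact: shiK. Qed.
Lemma t22K j x : t22 j (s22 j x) = x. Proof. exact: shiK. Qed.
Lemma s1_eq0 j x : s1 j x = 0 -> x = 0. Proof. exact: shi_eq0. Qed.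
Lemma s2_eq0 j x : s2 j x = 0 -> x = 0. Proof. exact: shi_eq0. Qed.
Lemma s22_eq0 j x : s22 j x = 0 -> x = 0. Proof. exact: shi_eq0. Qed.

(* the sum of the [M w], one summand for each nonzero path ending at [v]; here
   [next1 j], [next2 j] and [next22 j] are [M (j + 1, L1)], [M (j + 1, L2)] and
   [M (j + 2, L2)] *)
Definition free_obj (v : vertex) : lmodType R :=
  match v with
  | (j, L0) => (M (j, L0) * (next1 j * next22 j))%type
  | (j, L1) => ((M (j, L1) * M (j, L0)) * (next2 j * next1 j))%type
  | (j, L2) => (M (j, L2) * (M (j, L1) * M (j, L0)))%type
  end.

Definition free_arrow : arrows free_obj free_obj := fun u v a =>
  match a in zarrow u v return {linear free_obj u -> free_obj v} with
  | a01 j => pair_lin (pair_lin \0 fst) (pair_lin \0 (fst \o snd))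
  | a12 j => pair_lin \0 fst
  | a10 j => pair_lin \0 (pair_lin (s1 j \o (fst \o fst)) (s22 j \o (fst \o snd)))
  | a21 j => pair_lin \0 (pair_lin (s2 j \o fst) (\- (s1 j \o (fst \o snd))))
  end.

Definition free : zrep R.
Proof.
exists free_obj free_arrow => j x; pair_simpl.
- by rewrite !linear0.
- by rewrite linear0; congr pair; congr pair; rewrite /= ?subrr ?addr0.
- by [].
Defined.

Definition free_unit v : {linear M v -> free v} :=
  match v with
  | (j, L0) => pair_lin idfun \0
  | (j, L1) => pair_lin (pair_lin idfun \0) \0
  | (j, L2) => pair_lin idfun \0
  end.

Section UniversalProperty.
Variables (X : zrep R) (f : forall v, {linear M v -> X v}).

(** [next1_map], [next2_map] and [next22_map] are [f] followed by the action of the path from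
    [(j + 1, L1)], [(j + 1, L2)] and [(j + 2, L2)]. The arrows [a10] and [a21] end at index [j - 1],
    hence [shift_fam]. *)
Definition next1_map : forall j, {linear next1 j -> X (j, L0)} :=
  shift_fam (D := fun j => {linear next1 j -> X (j, L0)})
    (fun j => rep_map X (a10 j) \o (f (j, L1) \o t1 j)).
Definition next2_map : forall j, {linear next2 j -> X (j, L1)} :=
  shift_fam (D := fun j => {linear next2 j -> X (j, L1)})
    (fun j => rep_map X (a21 j) \o (f (j, L2) \o t2 j)).
Definition next22_map : forall j, {linear next22 j -> X (j, L0)} :=
  shift_fam (D := fun j => {linear next22 j -> X (j, L0)})
    (fun j => rep_map X (a10 j) \o (next2_map j \o t22 j)).

Lemma next1_mapE j x : next1_map (j - 1) (s1 j x) = rep_map X (a10 j) (f _ x).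
Proof. by rewrite /next1_map shift_famE /= t1K. Qed.
Lemma next2_mapE j x : next2_map (j - 1) (s2 j x) = rep_map X (a21 j) (f _ x).
Proof. by rewrite /next2_map shift_famE /= t2K. Qed.
Lemma next22_mapE j x :
  next22_map (j - 1) (s22 j x) = rep_map X (a10 j) (next2_map j x).
Proof. by rewrite /next22_map shift_famE /= t22K. Qed.

Lemma next1_map0 j x :
  rep_map X (a12 j) (rep_map X (a01 j) (next1_map j x)) = 0.
Proof.
elim/int_next_ind: j x => j x; rewrite -[x]s1K next1_mapE rep_square'.
by rewrite linearN rep_mesh2 oppr0.
Qed.

Lemma next2_map0 j x : rep_map X (a12 j) (next2_map j x) = 0.
Proof.
by elim/int_next_ind: j x => j x; rewrite -[x]s2K next2_mapE rep_mesh2.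
Qed.

Lemma next22_map0 j x : rep_map X (a01 j) (next22_map j x) = 0.
Proof.
elim/int_next_ind: j x => j x; rewrite -[x]s22K next22_mapE rep_square'.
by rewrite next2_map0 linear0 oppr0.
Qed.

Definition free_lift_rep_fun v : {linear free v -> X v} :=
  match v with
  | (j, L0) => copair_lin (f _) (copair_lin (next1_map j) (next22_map j))
  | (j, L1) => copair_lin (copair_lin (f _) (rep_map X (a01 j) \o f _))
      (copair_lin (next2_map j) (rep_map X (a01 j) \o next1_map j))
  | (j, L2) => copair_lin (f _) (copair_lin (rep_map X (a12 j) \o f _)
      (rep_map X (a12 j) \o (rep_map X (a01 j) \o f _)))
  end.

Definition free_rep_lift : zrep_mor free X.
Proof.
exists free_lift_rep_fun => u v a x; case: u v / a x => j x; pair_simpl;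
  rewrite ?linearD /=.
- by rewrite next22_map0 !linear0 !(addr0, add0r).
- by rewrite next1_map0 next2_map0 !linear0 !(addr0, add0r).
- by rewrite next1_mapE next22_mapE !rep_mesh0 !linear0 !(addr0, add0r).
- rewrite !linearN /= next2_mapE next1_mapE !linear0 !(addr0, add0r).
  by rewrite !rep_square rep_mesh0 !linear0 !addr0.
Defined.

Lemma free_rep_liftE v x : free_rep_lift v (free_unit v x) = f v x.
Proof. by case: v x => j [] x; pair_simpl; rewrite !linear0 !addr0. Qed.
End UniversalProperty.

(** Arrows carry the generators [free_unit] to every summand, and the vanishing of [d] propagates
    along them one summand at a time. *)
Lemma free_mor0 X (d : zrep_mor free X) :
  (forall v x, d v (free_unit v x) = 0) -> forall v x, d v x = 0.
Proof.
move=> d0.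
have dz1 j z : d (j, L0) (0, (z, 0)) = 0.
  elim/int_next_ind: j z => j z; rewrite -[z]s1K.
  have := rep_nat d (a10 j) (free_unit (j, L1) (t1 j z)); rewrite d0.
  by pair_simpl; rewrite !linear0.
have dz2 j z : d (j, L1) (0, (z, 0)) = 0.
  elim/int_next_ind: j z => j z; rewrite -[z]s2K.
  have := rep_nat d (a21 j) (free_unit (j, L2) (t2 j z)); rewrite d0.
  by pair_simpl; rewrite !linear0.
have dz22 j z : d (j, L0) (0, (0, z)) = 0.
  elim/int_next_ind: j z => j z; rewrite -[z]s22K.
  have := rep_nat d (a10 j) (0, (t22 j z, 0)); rewrite dz2.
  by pair_simpl; rewrite !linear0.
have dy1 j y : d (j, L1) ((0, y), 0) = 0.
  have := rep_nat d (a01 j) (free_unit (j, L0) y); rewrite d0.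
  by pair_simpl; rewrite !linear0.
have dw j w : d (j, L1) (0, (0, w)) = 0.
  have := rep_nat d (a01 j) (0, (w, 0)); rewrite dz1.
  by pair_simpl; rewrite !linear0.
have dy2 j y : d (j, L2) (0, (y, 0)) = 0.
  have := rep_nat d (a12 j) (free_unit (j, L1) y); rewrite d0.
  by pair_simpl; rewrite !linear0.
have dz j z : d (j, L2) (0, (0, z)) = 0.
  have := rep_nat d (a12 j) ((0, z), 0); rewrite dy1.
  by pair_simpl; rewrite !linear0.
case=> j [] x.
- case: x => x [y z].
  have -> : (x, (y, z)) = free_unit (j, L0) x + (0, (y, 0)) + (0, (0, z)) :> free (j, L0).
    by congr pair; [|congr pair]; rewrite /= ?(addr0, add0r).
  by rewrite !linearD d0 dz1 dz22 !addr0.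
- case: x => -[x y] [z w].
  have -> : ((x, y), (z, w)) = free_unit (j, L1) x + ((0, y), 0) +
      (0, (z, 0)) + (0, (0, w)) :> free (j, L1).
    by congr pair; congr pair; rewrite /= ?(addr0, add0r).
  by rewrite !linearD d0 dy1 dz2 dw !addr0.
- case: x => x [y z].
  have -> : (x, (y, z)) = free_unit (j, L2) x + (0, (y, 0)) + (0, (0, z)) :> free (j, L2).
    by congr pair; [|congr pair]; rewrite /= ?(addr0, add0r).
  by rewrite !linearD d0 dy2 dz !addr0.
Qed.

Lemma free_exact : exact_rep free.
Proof.
case=> j [] z; pair_simpl.
- case: z => -[x y] [z w] /= [/s1_eq0 -> /s22_eq0 ->].
  by exists (y, (w, 0)).
- case: z => -[x [y z]] [x' [y' z']] /= [].
  move=> _; rewrite addr0 => -> /eqP; rewrite add0r => /eqP/s2_eq0 ->.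
  move=> /eqP; rewrite subr_eq0 => /eqP ->.
  by exists ((y', z'), (t22 j z, 0)); pair_simpl; rewrite s22K.
- case: z => -[x y] [z w] /= [-> ->].
  exists (t2 j z, (- t1 j w, 0)); pair_simpl.
  by rewrite linearN opprK s1K s2K.
Qed.

Definition free_last v : {linear M v -> free (nv v)} := nak free v \o free_unit v.

Lemma free_lastE v x : free_last v x = nak free v (free_unit v x).
Proof. by []. Qed.

Lemma free_last_inj v x : free_last v x = 0 -> x = 0.
Proof.
case: v x => j [] x; rewrite /free_last; pair_simpl.
- by case.
- by case=> _ /eqP; rewrite oppr_eq0 => /eqP/s1_eq0.
- by case=> _ /s22_eq0/s2_eq0.
Qed.

Lemma free_last_im v y : din free (nv v) y = 0 -> exists x, free_last v x = y.
Proof.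
case: v y => j [] y; rewrite /free_last; pair_simpl.
- case: y => x [y z] /= [/s2_eq0 -> /eqP]; rewrite oppr_eq0 => /eqP/s1_eq0 ->.
  by exists z.
- case: y => -[x y] [z w] /= [_ /s22_eq0 -> -> ->].
  by exists (- t1 j w); rewrite !linear0 linearN opprK s1K.
- case: y => x [y z] /= [-> ->].
  by exists (t2 j (t22 (j - 1) z)); rewrite !linear0 s2K s22K.
Qed.

(** Modulo the images of the incoming arrows only the summand of the trivial path survives. *)
Lemma free_top v : exists r : {linear free v -> M v}, kills_in r /\
  forall (C : lmodType R) (c : {linear free v -> C}), kills_in c ->
  forall y, c y = c (free_unit v (r y)).
Proof.
exists (match v return {linear free v -> M v} with
  | (j, L0) => fst | (j, L1) => fst \o fst | (j, L2) => fst end).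
split=> [u a|C c c0 y]; first by case: u v / a.
apply/eqP; rewrite -subr_eq0 -linearB; apply/eqP.
case: v c c0 y => j [] c c0 y.
- elim/int_next_ind: j c c0 y => j c c0 [x [y z]].
  rewrite -[RHS](c0 _ (a10 j) ((t1 j y, 0), (t22 j z, 0))); congr (c _).
  by pair_simpl; rewrite s1K s22K; congr pair; [|congr pair]; rewrite /= ?subrr ?subr0.
- elim/int_next_ind: j c c0 y => j c c0 [[x y] [z w]].
  rewrite -[RHS](addr0 0) -{1}(c0 _ (a01 (j - 1)) (y, (w, 0))).
  rewrite -[X in _ = _ + X](c0 _ (a21 j) (t2 j z, (0, 0))) -linearD; congr (c _).
  by pair_simpl; rewrite s2K !linear0; congr pair; congr pair;
    rewrite /= ?subrr ?subr0 ?addr0 ?add0r.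
- case: y => x [y z]; rewrite -[RHS](c0 _ (a12 j) ((y, z), (0, 0))); congr (c _).
  by pair_simpl; congr pair; [|congr pair]; rewrite /= ?subrr ?subr0.
Qed.
End Free.

Section FreeMap.
Variables S T T' : vertex -> lmodType R.

Definition free_map_fun (f : forall v, {linear S v -> T v}) v :
    {linear free S v -> free T v} :=
  match v with
  | (j, L0) => prod_map (f _) (prod_map (f (j + 1, L1)) (f (j + 1 + 1, L2)))
  | (j, L1) => prod_map (prod_map (f _) (f _)) (prod_map (f (j + 1, L2)) (f (j + 1, L1)))
  | (j, L2) => prod_map (f _) (prod_map (f _) (f _))
  end.

Definition free_map (f : forall v, {linear S v -> T v}) :
  zrep_mor (free S) (free T).
Proof.
exists (free_map_fun f) => u v a x; case: u v / a x => j x; pair_simpl;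
  rewrite ?linear0 //.
- congr (_, (_, _)).
    exact: (shi_nat (fun j => f (j, L1))).
  exact: (shi_nat (fun j => f (j + 1, L2))).
- rewrite linearN; congr (_, (_, - _)).
    exact: (shi_nat (fun j => f (j, L2))).
  exact: (shi_nat (fun j => f (j, L1))).
Defined.

Lemma free_map_unit f v x : free_map f v (free_unit S v x) = free_unit T v (f v x).
Proof. by case: v x => j [] x; pair_simpl; rewrite !linear0. Qed.
End FreeMap.

Lemma free_map_exact S T T' (f : forall v, {linear S v -> T v})
    (g : forall v, {linear T v -> T' v}) :
  (forall v, mod_exact (f v) (g v)) ->
  rep_exact (free_map f) (free_map g).
Proof. by move=> fg [j []]; do ![apply: prod_map_exact]; apply: fg. Qed.

(** [free] is left adjoint to taking the underlying family of modules: lifts of the generators at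
    each vertex extend to a morphism, which is a section by [free_mor0]. *)
Lemma Ext1_free M Y : (forall v, Ext1_zero (C := modCat R) (M v) (Y v)) ->
  Ext1_zero (C := repCat R) (free M) Y.
Proof.
move=> extM; apply/rep_Ext1P => E i p ip.
have lifts v : exists l : {linear M v -> E v}, forall x, p v (l x) = free_unit M v x.
  exact: mod_lift (extM v) _ _ (i v) (p v) (free_unit M v) (ip v).
pose l v := projT1 (cid (lifts v)).
have lE v x : p v (l v x) = free_unit M v x := projT2 (cid (lifts v)) x.
exists (free_rep_lift l) => v x; apply/eqP; rewrite -subr_eq0; apply/eqP.
apply: (free_mor0 (d := rep_addm (rep_comp p (free_rep_lift l)) (rep_oppm (rep_id _)))).
by move=> {}v {}x; rewrite /= [free_lift_rep_fun _ _ _]free_rep_liftE lE subrr.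
Qed.

(** Dual to [Ext1_free], by the universal property of [cofree] and [cofree_mor0]. *)
Lemma Ext1_cofree X N : (forall v, Ext1_zero (C := modCat R) (X v) (N v)) ->
  Ext1_zero (C := repCat R) X (cofree N).
Proof.
move=> extN; apply/rep_Ext1_retr => E i p ip.
have exts v : exists l : {linear E v -> N v}, forall x, l (i v x) = cofree_pr N v x.
  exact: mod_extend (extN v) _ _ (i v) (p v) (cofree_pr N v) (ip v).
pose l v := projT1 (cid (exts v)).
have lE v x : l v (i v x) = cofree_pr N v x := projT2 (cid (exts v)) x.
exists (cofree_lift l) => v x; apply/eqP; rewrite -subr_eq0; apply/eqP.
apply: (cofree_mor0 (d := rep_addm (rep_comp (cofree_lift l) i) (rep_oppm (rep_id _)))).
move=> {}v {}x; rewrite /= linearB /=.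
by rewrite [cofree_pr _ _ (cofree_lift_fun _ _ _)]cofree_liftE lE subrr.
Qed.

(** The extension at [v0], completed by split ones, stays exact after applying [free]. The counit
    [free X -> X] extends to the middle term, and its restriction to the generators at [v0] is the
    retraction. *)
Lemma Ext1_of_free X v0 (A : lmodType R) :
  Ext1_zero (C := repCat R) (free (fun=> A)) X ->
  Ext1_zero (C := modCat R) A (X v0).
Proof.
move=> extX; apply/mod_Ext1_retr => E0 i0 p0 ip0.
pose D v := {E : lmodType R & {i : {linear X v -> E} &
  {p : {linear E -> A} | mod_exact i p}}}.
pose dflt v : D v := existT _ _ (existT _ _ (exist _ _ (prod_exact (X v) A))).
pose d0 : D v0 := existT _ _ (existT _ _ (exist _ _ ip0)).
pose d := upd dflt d0.
pose Ev v : lmodType R := projT1 (d v).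
pose iv v : {linear X v -> Ev v} := projT1 (projT2 (d v)).
pose pv v : {linear Ev v -> A} := sval (projT2 (projT2 (d v))).
have ex v : mod_exact (iv v) (pv v) := svalP (projT2 (projT2 (d v))).
pose eps : zrep_mor (free X) X := free_rep_lift (fun v => idfun : {linear X v -> X v}).
have [h hE] := rep_extend extX eps (free_map_exact ex).
pose Q v (x : D v) := exists h : {linear projT1 x -> X v},
  forall y, h (projT1 (projT2 x) y) = y.
have : Q v0 (d v0).
  exists (h v0 \o free_unit Ev v0) => y.
  rewrite -[RHS](free_rep_liftE (fun v => idfun : {linear X v -> X v})) -[RHS]hE.
  by rewrite free_map_unit.
by rewrite /d upd_in.
Qed.

(** Dual to [Ext1_of_free]: the unit [X -> cofree X] is lifted, and the section is read off through
    [cofree_pr]. *)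
Lemma Ext1_of_cofree X v0 (B : lmodType R) :
  Ext1_zero (C := repCat R) X (cofree (fun=> B)) ->
  Ext1_zero (C := modCat R) (X v0) B.
Proof.
move=> extX; apply/mod_Ext1P => E0 i0 p0 ip0.
pose D v := {E : lmodType R & {i : {linear B -> E} &
  {p : {linear E -> X v} | mod_exact i p}}}.
pose dflt v : D v := existT _ _ (existT _ _ (exist _ _ (prod_exact B (X v)))).
pose d0 : D v0 := existT _ _ (existT _ _ (exist _ _ ip0)).
pose d := upd dflt d0.
pose Ev v : lmodType R := projT1 (d v).
pose iv v : {linear B -> Ev v} := projT1 (projT2 (d v)).
pose pv v : {linear Ev v -> X v} := sval (projT2 (projT2 (d v))).
have ex v : mod_exact (iv v) (pv v) := svalP (projT2 (projT2 (d v))).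
pose eta : zrep_mor X (cofree X) := cofree_lift (fun v => idfun : {linear X v -> X v}).
have [h hE] := rep_lift extX eta (cofree_map_exact ex).
pose Q v (x : D v) := exists h : {linear X v -> projT1 x},
  forall y, sval (projT2 (projT2 x)) (h y) = y.
have : Q v0 (d v0).
  exists (cofree_pr Ev v0 \o h v0) => y.
  rewrite -[RHS](cofree_liftE (fun v => idfun : {linear X v -> X v})) -[X in _ = _ X]hE.
  by rewrite cofree_map_pr.
by rewrite /d upd_in.
Qed.

End Contractible.

(** * Closure properties of the given cotorsion pair *)

Section CotorsionPairs.
Variables (k : fieldType) (R : pzRingType) (iota : {rmorphism k -> R}).
Variables A B : modCat R -> Prop.
Hypothesis hAB : hereditary_cotorsion_pair A B.
Implicit Types (U V W : lmodType R) (T M N : vertex -> lmodType R) (X Y Z E : zrep R).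

Lemma inA U : A U <-> forall V, B V -> Ext1_zero (C := modCat R) U V.
Proof. by have [[AP _] _ _] := hAB; apply: AP. Qed.

Lemma inB V : B V <-> forall U, A U -> Ext1_zero (C := modCat R) U V.
Proof. by have [[_ BP] _ _] := hAB; rewrite -BP. Qed.

Lemma Ext1_AB U V : A U -> B V -> Ext1_zero (C := modCat R) U V.
Proof. by move=> /inA; apply. Qed.

Lemma A_retract U U' (s : {linear U' -> U}) (r : {linear U -> U'}) :
  (forall x, r (s x) = x) -> A U -> A U'.
Proof. by move=> rs /inA AU; apply/inA => V /AU; apply: Ext1_retractl rs. Qed.

Lemma B_retract V V' (s : {linear V' -> V}) (r : {linear V -> V'}) :
  (forall x, r (s x) = x) -> B V -> B V'.
Proof. by move=> rs /inB BV; apply/inB => U /BV; apply: Ext1_retractr rs. Qed.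

Lemma A_prod U U' : A U -> A U' -> A (U * U')%type.
Proof.
move=> /inA AU /inA AU'; apply/inA => V BV.
by apply: Ext1_prodl; [apply: AU|apply: AU'].
Qed.

Lemma B_prod V V' : B V -> B V' -> B (V * V')%type.
Proof.
move=> /inB BV /inB BV'; apply/inB => U AU.
by apply: Ext1_prodr; [apply: BV|apply: BV'].
Qed.

Lemma A_Free U : A (Free U).
Proof. by apply/inA => V _; apply: Ext1_Free. Qed.

Lemma B_Coind U : B (Coind iota U).
Proof. by apply/inB => V _; apply: Ext1_Coind. Qed.

Lemma lin_inverse U V (f : {linear U -> V}) : injective f ->
  (forall v, exists u, f u = v) ->
  exists g : {linear V -> U}, (forall v, f (g v) = v) /\ forall u, g (f u) = u.
Proof.
move=> f_inj f_surj.
have fV v : exists u, f u = (idfun : {linear V -> V}) v by apply: f_surj.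
have gE v : f (lin_lift f_inj fV v) = v by apply: lin_liftE.
by exists (lin_lift f_inj fV); split=> // u; apply: (f_inj).
Qed.

Lemma A_iso U V (f : {linear U -> V}) : injective f ->
  (forall v, exists u, f u = v) -> A U <-> A V.
Proof.
move=> f_inj f_surj; have [g [fg gf]] := lin_inverse f_inj f_surj.
by split; [apply: A_retract fg|apply: A_retract gf].
Qed.

Lemma B_iso U V (f : {linear U -> V}) : injective f ->
  (forall v, exists u, f u = v) -> B U <-> B V.
Proof.
move=> f_inj f_surj; have [g [fg gf]] := lin_inverse f_inj f_surj.
by split; [apply: B_retract fg|apply: B_retract gf].
Qed.

Lemma A_ker U V W (i : {linear U -> V}) (p : {linear V -> W}) :
  mod_exact i p -> A V -> A W -> A U.
Proof.
have [_ /closed_ker_epiP cl _] := hAB.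
by move=> /mod_exactP; apply: cl.
Qed.

Lemma B_coker U V W (i : {linear U -> V}) (p : {linear V -> W}) :
  mod_exact i p -> B U -> B V -> B W.
Proof.
have [_ _ /closed_coker_monoP cl] := hAB.
by move=> /mod_exactP; apply: cl.
Qed.

(** * Phi(A) and Psi(B) as orthogonals of null representations; the two hereditary pairs *)

Lemma Phi_null X (T : zrep R) : Phi A X -> null_rep T -> (forall v, B (T v)) ->
  Ext1_zero (C := repCat R) X T.
Proof.
move=> /PhiP[AX exX] T0 BT; apply: Ext1_null_r => // m.
exact: Ext1_AB.
Qed.

Lemma Psi_null X (T : zrep R) : Psi B X -> null_rep T -> (forall v, A (T v)) ->
  Ext1_zero (C := repCat R) T X.
Proof.
move=> /PsiP[BX exX] T0 AT; apply: Ext1_null_l => // m.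
exact: Ext1_AB.
Qed.

(** For exactness, the maps from [Mid X m] to the cokernel of [din X m], embedded in a coinduced
    module, form a cocycle. By [null_extension_r] it vanishes on cycles, so every cycle is a
    boundary. *)
Lemma Phi_of_null X : (forall T, (forall v, B (T v)) ->
  Ext1_zero (C := repCat R) X (triv T)) -> Phi A X.
Proof.
move=> extX; apply/PhiP; split=> [m|m z z0].
  by apply/inA => V BV; apply: Coker_Ext1; apply: extX.
pose N l j : lmodType R := Coind iota (Coker (din X (j, l))).
(* The value of [T] at [vnext m] must come from the mesh with source [m], hence [v.1 + 1]; [shi]
   absorbs the difference between [j - 1 + 1] and [j]. *)
pose T (v : vertex) : lmodType R := N v.2 (v.1 + 1).
pose f (m : vertex) : {linear Mid X m -> T (vnext m)} :=
  match m with (j, l) =>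
    shi (N l) j \o (coind_unit iota _ \o coker_proj (din X (j, l))) end.
have f_din n x : f n (din X n x) = 0.
  case: n x => j l x /=; rewrite (_ : coker_proj _ _ = 0) ?linear0 //.
  by apply/coker_proj_eq0; exists x.
have BT v : B (T v) by apply: B_Coind.
have := null_extension_r f_din (extX T BT) z0.
case: m z z0 => j l z z0 /= /shi_eq0 cz.
have /coker_proj_eq0[x _ <-] : coker_proj (din X (j, l)) z = 0.
  by apply: (@coind_unit_inj _ _ iota); rewrite linear0.
by exists x.
Qed.

(** For exactness, a free module is mapped onto the cycles of each mesh; by [null_extension_l] the
    image of this map consists of boundaries. *)
Lemma Psi_of_null X : (forall T, (forall v, A (T v)) ->
  Ext1_zero (C := repCat R) (triv T) X) -> Psi B X.
Proof.
move=> extX; apply/PsiP; split=> [m|m z z0].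
  by apply/inB => V BV; apply: Ker_Ext1; apply: extX.
pose T (v : vertex) : lmodType R := Free (Ker (dout X v)).
pose f (m : vertex) : {linear T m -> Mid X m} :=
  ker_incl (dout X m) \o free_lift id.
have f_dout n x : dout X n (f n x) = 0.
  by apply/ker_inclP; exists (free_lift id x).
have AT v : A (T v) by apply: A_Free.
have /ker_inclP[y _ yE] := z0.
have [x xE] := null_extension_l f_dout (extX T AT) (free_gen y).
by exists x; rewrite xE /f /= free_cover.
Qed.

Lemma Phi_ker X Y Z (i : zrep_mor X Y) (p : zrep_mor Y Z) :
  rep_exact i p -> Phi A Y -> Phi A Z -> Phi A X.
Proof.
move=> ip /PhiP[AY exY] /PhiP[AZ exZ]; apply/PhiP; split=> [m|].
  by have [i' [p' [ip' _]]] := coker_exact ip m exZ; apply: A_ker ip' _ _.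
exact: exact_rep_ker ip _ _.
Qed.

Lemma Psi_coker X Y Z (i : zrep_mor X Y) (p : zrep_mor Y Z) :
  rep_exact i p -> Psi B X -> Psi B Y -> Psi B Z.
Proof.
move=> ip /PsiP[BX exX] /PsiP[BY exY]; apply/PsiP; split=> [m|].
  by have [i' [p' [ip' _]]] := ker_exact ip m exX; apply: B_coker ip' _ _.
exact: exact_rep_coker ip _ _.
Qed.

Lemma Phi_free M : (forall v, A (M v)) -> Phi A (free M).
Proof.
move=> AM; apply: Phi_of_null => T BT.
by apply: Ext1_free => v; apply: Ext1_AB.
Qed.

Lemma Psi_cofree N : (forall v, B (N v)) -> Psi B (cofree N).
Proof.
move=> BN; apply: Psi_of_null => T AT.
by apply: Ext1_cofree => v; apply: Ext1_AB.
Qed.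

(** Being the left orthogonal of a class of null representations, Phi(A) is its own double
    orthogonal. Free representations on free modules are the covers needed by [rep_coker_closed]. *)
Lemma Phi_pair : hereditary_cotorsion_pair (C := repCat R) (Phi A)
  (rperp (C := repCat R) (Phi A)).
Proof.
have clPhi : closed_ker_epi (C := repCat R) (Phi A).
  by apply/closed_ker_epiP => X Y Z i p /rep_exactP; apply: Phi_ker.
split=> //; first split=> [X|Y] //.
  split=> [PX Y rY|lX]; first exact: rY.
  apply: Phi_of_null => T BT; apply: lX => Y PY.
  exact: Phi_null.
apply: rep_coker_closed => // E.
exists (free (fun v => Free (E v))), (free_rep_lift (fun v => free_lift id)).
split=> [|v y]; first by apply: Phi_free => v; apply: A_Free.
by exists (free_unit _ v (free_gen y)); rewrite free_rep_liftE free_cover.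
Qed.

(** Dual to [Phi_pair]; every object embeds in a cofree representation on coinduced modules. *)
Lemma Psi_pair : hereditary_cotorsion_pair (C := repCat R)
  (lperp (C := repCat R) (Psi B)) (Psi B).
Proof.
have clPsi : closed_coker_mono (C := repCat R) (Psi B).
  by apply/closed_coker_monoP => X Y Z i p /rep_exactP; apply: Psi_coker.
split=> //; first split=> [X|Y] //.
  split=> [rY|PY X lX]; last exact: lX.
  apply: Psi_of_null => T AT; apply: rY => X PX.
  exact: Psi_null.
apply: rep_ker_closed => // E.
exists (cofree (fun v => Coind iota (E v))).
exists (cofree_lift (fun v => coind_unit iota (E v))).
split=> [|v]; first by apply: Psi_cofree => v; apply: B_Coind.
apply: ker0_inj => x /(congr1 (cofree_pr _ v)).
rewrite cofree_liftE linear0 -(linear0 (coind_unit iota (E v))).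
exact: coind_unit_inj.
Qed.

(* [Y] is filtered with layers [Ker (din Y v)] (the socle), [Mid] of these
   kernels, and [Ker (din Y (nv v))]. *)
Lemma Ext1_Phi_Psi X Y : Phi A X -> Psi B Y -> Ext1_zero (C := repCat R) X Y.
Proof.
move=> PX /PsiP[BY exY].
pose K v : lmodType R := Ker (din Y v); pose kY v := ker_incl (din Y v).
have kY_inj v : injective (kY v) by apply: ker_incl_inj.
have din_k v x : din Y v (kY v x) = 0 by apply/ker_inclP; exists x.
have killed v x : din Y v x = 0 -> exists y, kY v y = x.
  by move=> /ker_inclP[y _ <-]; exists y.
have nak_k v x : din Y v x = 0 -> nak Y v x = 0.
  move=> /din_eq0 x0; case: v x x0 => j [] x x0 /=; by rewrite x0 linear0.
have nakL v x : exists y, kY (nv v) y = nak Y v x by apply/killed/din_nak.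
pose q v := lin_lift (kY_inj (nv v)) (nakL v).
have qE v x : kY _ (q v x) = nak Y v x by apply: lin_liftE.
have q_kills v : kills_in (q v).
  move=> u a x; apply: (kY_inj); rewrite qE linear0.
  exact: nak_kills.
pose Q := to_triv q_kills.
have Q_surj v y : exists x, Q v x = y.
  have [x xE] := nak_im exY (din_k _ y); exists x.
  by apply: (kY_inj); rewrite qE.
(* The top layer: the longest paths map [Y] onto the kernels at [nv v], and [P] is the part of [Y]
   they kill. *)
have ex1 := rep_ker Q_surj; set P := kerrep Q in ex1.
pose kP : zrep_mor P Y := kerrep_incl Q.
have kP_inj v : injective (kP v) by apply: ker_incl_inj.
have kPP v x : nak Y v x = 0 <-> exists y, kP v y = x.
  have [_ _ <-] := ex1 v; rewrite -qE; split=> [|->]; last by rewrite linear0.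
  by rewrite -(linear0 (kY (nv v))) => /kY_inj.
apply: (rep_Ext1_middle ex1); last by apply: Phi_null => // v; apply: BY.
have mk_inj v : injective (mid_map kY v).
  case: v => j []; [exact: kY_inj| |exact: kY_inj].
  by case=> [x y] [x' y'] /= [/kY_inj -> /kY_inj ->].
(* An arrow applied to an element of [P] gives an element killed by all further arrows, so [din Y]
   maps [P] into the kernels in the middle of the mesh. *)
have dinL v x : exists y, mid_map kY v y = (din Y v \o kP v) x.
  have : nak Y v (kP v x) = 0 by apply/kPP; exists x.
  rewrite -[(_ \o _) x]/(din Y v (kP v x)); move: (kP v x) => y.
  case: v {x} y => j [] x /= x0.
  - by apply: killed; rewrite /= /pair_fun rep_mesh0 x0.
  - have [|y1 y1E] := killed (j - 1, L0) (rep_map Y (a10 j) x).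
      by rewrite /= rep_square' x0 oppr0.
    have [|y2 y2E] := killed (j, L2) (rep_map Y (a12 j) x) => //.
    by exists (y1, y2); congr pair; [exact: y1E|exact: y2E].
  - by apply: killed; rewrite /= /pair_fun rep_mesh2 x0.
pose r v := lin_lift (mk_inj v) (dinL v).
have rE v x : mid_map kY v (r v x) = din Y v (kP v x) by apply: lin_liftE.
have dout_mk v y : dout Y v (mid_map kY v y) = 0.
  case: v y => j [] y /=.
  - by have /din_eq0 := din_k _ y; apply.
  - rewrite /copair_fun /=; have /din_eq0 -> := din_k _ y.1.
    by have /din_eq0 -> := din_k _ y.2; rewrite addr0.
  - by have /din_eq0 := din_k _ y; apply.
have r_kills v : kills_in (r v).
  move=> u a x; apply: (mk_inj); rewrite rE linear0 rep_nat.
  have : nak Y u (kP u x) = 0 by apply/kPP; exists x.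
  move: (kP u x) => y; case: u v / a {x} y => j x /= x0; rewrite ?/pair_fun.
  - by rewrite rep_mesh0 x0.
  - by [].
  - by rewrite rep_square' x0 oppr0.
  - by rewrite rep_mesh2 x0.
pose W := to_triv r_kills.
pose j0 : zrep_mor (triv K) Y := from_triv din_k.
have jP v x : exists y, kP v y = j0 v x by apply/kPP/nak_k/din_k.
have [j jE] := rep_lift_ex kP_inj jP.
have ex2 : rep_exact j W.
  move=> v; split=> [x x' /(congr1 (kP v))|y|x].
  - by rewrite !jE => /kY_inj.
  (* Kernel elements in the middle are cycles, hence boundaries of some [z]; the longest path on [z]
     runs through them and vanishes, so [z] is in [P]. *)
  - have [z zE] := exY _ _ (dout_mk v y).
    have [|x xE] := (kPP v z).1; last by exists x; apply: (mk_inj); rewrite rE xE.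
    case: v y z zE => i [] y z /= zE.
    + by rewrite zE; have /din_eq0 := din_k _ y; apply.
    + by case: zE => _ ->; have /din_eq0 := din_k _ y.2; apply.
    + by rewrite zE; have /din_eq0 := din_k _ y; apply.
  - split=> [/(congr1 (mid_map kY v))|[y <-]].
      rewrite rE linear0 => /killed[y yE]; exists y.
      by apply: (kP_inj); rewrite jE.
    by apply: (mk_inj); rewrite rE jE linear0 din_k.
apply: (rep_Ext1_middle ex2); apply: Phi_null => // v.
by case: v => i []; [exact: BY|apply: B_prod; exact: BY|exact: BY].
Qed.

(** * Values at vertices, free and cofree resolutions, and compatibility *)

Lemma Phi_vertex X v : Phi A X -> A (X v).
Proof.
move=> PX; apply/inA => V BV; apply: Ext1_of_cofree.
by apply: Ext1_Phi_Psi => //; apply: Psi_cofree.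
Qed.

Lemma Psi_vertex X v : Psi B X -> B (X v).
Proof.
move=> PX; apply/inB => U AU; apply: Ext1_of_free.
by apply: Ext1_Phi_Psi => //; apply: Phi_free.
Qed.

Lemma rperp_Phi_vertex X v : rperp (C := repCat R) (Phi A) X -> B (X v).
Proof.
move=> rX; apply/inB => U AU; apply: Ext1_of_free.
by apply: rX; apply: Phi_free.
Qed.

Lemma lperp_Psi_vertex X v : lperp (C := repCat R) (Psi B) X -> A (X v).
Proof.
move=> lX; apply/inA => V BV; apply: Ext1_of_cofree.
by apply: lX; apply: Psi_cofree.
Qed.

Lemma A_Mid T m : (forall v, A (T v)) -> A (Mid T m).
Proof. by move=> AT; case: m => j []; rewrite /=; do ?apply: A_prod. Qed.

Lemma B_Mid T m : (forall v, B (T v)) -> B (Mid T m).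
Proof. by move=> BT; case: m => j []; rewrite /=; do ?apply: B_prod. Qed.

(** The image of [dout X m] is the kernel of a surjection between objects of A, hence in A; the same
    argument applies to the surjection of [Mid X m] onto this image. *)
Lemma A_ker_dout X m : Phi A X -> A (Ker (dout X m)).
Proof.
move=> PX; have /PhiP[AX _] := PX; pose c := coker_proj (dout X m).
have AI : A (Ker c).
  apply: (A_ker (mod_ker (p := c) (@coker_proj_surj _ _ _ _))) => //.
  exact: Phi_vertex.
have dI z : exists y, ker_incl c y = dout X m z.
  have /ker_inclP[y _ yE] : c (dout X m z) = 0 by apply/coker_proj_eq0; exists z.
  by exists y.
pose d := lin_lift (@ker_incl_inj _ _ _ c) dI.
have dE z : ker_incl c (d z) = dout X m z by apply: lin_liftE.
apply: (A_ker (i := ker_incl (dout X m)) (p := d)) => //; last first.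
  by apply: A_Mid => v; apply: Phi_vertex.
split=> [|y|z]; first exact: ker_incl_inj.
  have /coker_proj_eq0[z _ zE] : c (ker_incl c y) = 0 by apply/ker_inclP; exists y.
  by exists z; apply: (@ker_incl_inj _ _ _ c); rewrite dE.
transitivity (dout X m z = 0).
  by rewrite -dE; split=> [->|]; rewrite ?linear0 // -(linear0 (ker_incl c)) => /ker_incl_inj.
by rewrite ker_inclP; split=> -[y]; [exists y|exists y].
Qed.

(** Dual to [A_ker_dout]: first the image of [din X m], then the quotient of [Mid X m] by it, is a
    cokernel of a monomorphism in B. *)
Lemma B_coker_din X m : Psi B X -> B (Coker (din X m)).
Proof.
move=> PX; have /PsiP[BX _] := PX; pose c := coker_proj (din X m).
have dI x : exists y, ker_incl c y = din X m x.
  have /ker_inclP[y _ yE] : c (din X m x) = 0 by apply/coker_proj_eq0; exists x.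
  by exists y.
pose d := lin_lift (@ker_incl_inj _ _ _ c) dI.
have dE z : ker_incl c (d z) = din X m z by apply: lin_liftE.
have BI : B (Ker c).
  apply: (B_coker (i := ker_incl (din X m)) (p := d)) => //; last first.
    exact: Psi_vertex.
  split=> [|y|z]; first exact: ker_incl_inj.
    have /coker_proj_eq0[z _ zE] : c (ker_incl c y) = 0 by apply/ker_inclP; exists y.
    by exists z; apply: (@ker_incl_inj _ _ _ c); rewrite dE.
  transitivity (din X m z = 0).
    by rewrite -dE; split=> [->|]; rewrite ?linear0 // -(linear0 (ker_incl c)) => /ker_incl_inj.
  by rewrite ker_inclP; split=> -[y]; [exists y|exists y].
apply: (B_coker (mod_ker (p := c) (@coker_proj_surj _ _ _ _))) => //.
by apply: B_Mid => v; apply: Psi_vertex.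
Qed.

(** Let Z be the cokernel of [eta] and w = [nv (vnext m)]. Projecting to the last factor [X w] and
    applying [din X w] identifies the cokernel of [dout Z m] with [Ker (dout X w)], so that
    [A_ker_dout] applies. *)
Lemma Phi_coker_cofree X (eta := cofree_lift (fun v => idfun : {linear X v -> X v})) :
  Phi A X -> rep_exact eta (cokerrep_proj eta) /\ Phi A (cokerrep eta).
Proof.
move=> PX; have /PhiP[_ exX] := PX.
have eta_inj v : injective (eta v).
  by move=> x y /(congr1 (cofree_pr X v)); rewrite !cofree_liftE.
have ex := rep_coker eta_inj; split=> //.
set Z := cokerrep eta in ex *; set p := cokerrep_proj eta in ex.
have exZ : exact_rep Z by apply: (exact_rep_coker ex exX); apply: cofree_exact.
apply/PhiP; split=> // m.
have [_ p_surj ker_p] := ex (vnext m); have [_ mp_surj _] := mid_exact ex m.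
pose w := nv (vnext m).
have din_im y : exists t, ker_incl (dout X w) t = (din X w \o cofree_last X (vnext m)) y.
  have /ker_inclP[t _ tE] := mesh_rel (cofree_last X (vnext m) y).
  by exists t.
pose g := lin_lift (@ker_incl_inj _ _ _ (dout X w)) din_im.
have gE y : ker_incl (dout X w) (g y) = din X w (cofree_last X _ y) by apply: lin_liftE.
(* On the image of [eta] the last factor is the longest path; by [nak_im] and [cofree_last_ker] the
   kernel of [g] is this image plus that of the incoming arrows. *)
have g0 y : g y = 0 <-> exists x z, y = eta _ x + dout _ m z.
  have -> : g y = 0 <-> din X w (cofree_last X _ y) = 0.
    by rewrite -gE; split=> [->|]; rewrite ?linear0 //
      -(linear0 (ker_incl (dout X w))) => /ker_incl_inj.
  have last_eta x : cofree_last X (vnext m) (eta _ x) = nak X _ x.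
    by rewrite cofree_lastE -nak_nat cofree_liftE.
  split=> [/nak_im[//|x xE]|[x [z ->]]].
    have [|z zE] := cofree_last_ker (x := y - eta _ x).
      by rewrite linearB last_eta xE subrr.
    by exists x, z; rewrite zE addrC subrK.
  by rewrite linearD last_eta linearD din_nak add0r cofree_lastE nak_dout !linear0.
have gZ y : p _ y = 0 -> g y = 0.
  by move=> /ker_p[x <-]; apply/g0; exists x, 0; rewrite linear0 addr0.
pose h := lin_desc p_surj gZ.
have hE y : h (p _ y) = g y by apply: lin_descE.
have hC z : coker_proj (dout Z m) z = 0 -> h z = 0.
  move=> /coker_proj_eq0[t _ <-]; have [y <-] := mp_surj t.
  rewrite -mid_map_dout hE; apply/g0; exists 0, y.
  by rewrite linear0 add0r.
pose f := lin_desc (coker_proj_surj (f := dout Z m)) hC.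
have fE z : f (coker_proj (dout Z m) z) = h z by apply: lin_descE.
apply/(A_iso (f := f)); last exact: A_ker_dout.
  apply: ker0_inj => u; have [z <-] := coker_proj_surj u.
  have [y <-] := p_surj z; rewrite fE hE => /g0[x [t ->]].
  apply/coker_proj_eq0; exists (mid_map p m t) => //.
  rewrite -mid_map_dout linearD (_ : p _ (eta _ x) = 0) ?add0r //.
  by apply/ker_p; exists x.
move=> t; have [|x xE] := exX w (ker_incl (dout X w) t).
  by apply/ker_inclP; exists t.
have [y yE] := cofree_last_surj x.
exists (coker_proj (dout Z m) (p _ y)); apply: (@ker_incl_inj _ _ _ (dout X w)).
by rewrite fE hE gE yE.
Qed.

(** Let Z be the kernel of [eps]. Applying [dout X m] and then [free_last] identifies the cokernel
    of [din X m] with the kernel of [din Z] at [nv (vnext m)], so that [B_coker_din] applies. *)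
Lemma Psi_ker_free X (eps := free_rep_lift (fun v => idfun : {linear X v -> X v})) :
  Psi B X -> rep_exact (kerrep_incl eps) eps /\ Psi B (kerrep eps).
Proof.
move=> PX; have /PsiP[_ exX] := PX.
have eps_surj v x : exists y, eps v y = x.
  by exists (free_unit X v x); rewrite free_rep_liftE.
have ex := rep_ker eps_surj; split=> //.
set Z := kerrep eps in ex *; set i := kerrep_incl eps in ex.
have exZ : exact_rep Z by apply: (exact_rep_ker ex) exX; apply: free_exact.
apply/PsiP; split=> //; elim/vertex_nv_ind; elim/vertex_next_ind => m.
have [i_inj _ ker_i] := ex (nv (vnext m)).
have [mi_inj _ _] := mid_exact ex (nv (vnext m)).
pose last := free_last X (vnext m).
have last_eps x : eps _ (last x) = nak X _ x.
  by rewrite /last free_lastE nak_nat free_rep_liftE.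
have dout_im z : exists y, i _ y = (last \o dout X m) z.
  by apply/ker_i; rewrite [LHS]last_eps nak_dout.
pose g := lin_lift i_inj dout_im.
have gE z : i _ (g z) = last (dout X m z) by apply: lin_liftE.
have din_last x : din (free X) (nv (vnext m)) (last x) = 0 by apply: din_nak.
have gK z : exists y, ker_incl (din Z (nv (vnext m))) y = g z.
  have /ker_inclP[y _ yE] : din Z (nv (vnext m)) (g z) = 0.
    by apply: mi_inj; rewrite mid_map_din gE din_last linear0.
  by exists y.
pose h := lin_lift (@ker_incl_inj _ _ _ (din Z (nv (vnext m)))) gK.
have hE z : ker_incl (din Z (nv (vnext m))) (h z) = g z by apply: lin_liftE.
have h0 z : h z = 0 <-> dout X m z = 0.
  rewrite -(linear0 h); split=> [|z0]; last first.
    apply: (@ker_incl_inj _ _ _ (din Z (nv (vnext m)))); rewrite !hE.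
    by apply: (i_inj); rewrite !gE z0 linear0.
  move=> /(congr1 (ker_incl (din Z (nv (vnext m))))); rewrite !hE.
  move=> /(congr1 (i _)); rewrite !gE !linear0.
  exact: free_last_inj.
have hC z : coker_proj (din X m) z = 0 -> h z = 0.
  by move=> /coker_proj_eq0[x _ <-]; apply/h0; apply: mesh_rel.
pose f := lin_desc (coker_proj_surj (f := din X m)) hC.
have fE z : f (coker_proj (din X m) z) = h z by apply: lin_descE.
apply/(B_iso (f := f)); last exact: B_coker_din.
  apply: ker0_inj => u; have [z <-] := coker_proj_surj u.
  rewrite fE => /h0/exX[x xE].
  by apply/coker_proj_eq0; exists x.
move=> t; pose y := ker_incl (din Z (nv (vnext m))) t.
have y0 : din Z (nv (vnext m)) y = 0 by apply/ker_inclP; exists t.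
have [|x xE] := free_last_im (M := X) (v := vnext m) (y := i _ y).
  by rewrite -mid_map_din y0 linear0.
have [|z zE] := nak_ker exX (x := x).
  by rewrite -last_eps /last xE; apply/ker_i; exists y.
exists (coker_proj (din X m) z); apply: (@ker_incl_inj _ _ _ (din Z (nv (vnext m)))).
by rewrite fE hE; apply: (i_inj); rewrite gE zE xE.
Qed.

(** Ext^1 of the cokernel of [eta] by [X] vanishes, so [eta] has a retraction [r]. The trivial-path
    factor of [cofree X] is [X v], and [r] maps it to the kernel of [din X v]; this retracts [X v]
    onto that kernel. *)
Lemma Phi_rperp_Psi X : Phi A X -> rperp (C := repCat R) (Phi A) X -> Psi B X.
Proof.
move=> PX rX; have /PhiP[_ exX] := PX; apply/PsiP; split=> // v.
have [ex PZ] := Phi_coker_cofree PX.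
have [r rE] := (rep_Ext1_retr _ _).1 (rX _ PZ) _ _ _ ex.
set eta := cofree_lift _ in rE.
have [j [j0 jE]] := cofree_socle X v.
have rj0 x : exists y, ker_incl (din X v) y = (r v \o j) x.
  have /ker_inclP[y _ yE] : din X v (r v (j x)) = 0.
    by rewrite -mid_map_din j0 linear0.
  by exists y.
pose q := lin_lift (@ker_incl_inj _ _ _ (din X v)) rj0.
apply: (B_retract (s := ker_incl (din X v)) (r := q)); last exact: rperp_Phi_vertex.
move=> y; apply: (@ker_incl_inj _ _ _ (din X v)); rewrite lin_liftE /=.
have y0 : din X v (ker_incl (din X v) y) = 0 by apply/ker_inclP; exists y.
rewrite -[RHS]rE; congr (r v _); rewrite [RHS]jE ?cofree_liftE //.
by rewrite -mid_map_din y0 linear0.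
Qed.

(** Dually, [eps] has a section [s]. Following [s] by the projection to the trivial-path summand
    gives an endomorphism of [X] at [vnext m] that kills the image of [dout X m] and induces a
    section of the projection onto the cokernel. *)
Lemma Psi_lperp_Phi X : Psi B X -> lperp (C := repCat R) (Psi B) X -> Phi A X.
Proof.
move=> PX lX; have /PsiP[_ exX] := PX; apply/PhiP; split=> // m.
have [ex PZ] := Psi_ker_free PX.
have [s sE] := (rep_Ext1P _ _).1 (lX _ PZ) _ _ _ ex.
set eps := free_rep_lift _ in sE.
have [r [r_kills rE]] := free_top X (vnext m).
have rs0 x : coker_proj (dout X m) x = 0 -> (r \o s _) x = 0.
  move=> /coker_proj_eq0[z _ <-] /=; rewrite mid_map_dout.
  exact: (kills_inP r).1 r_kills _.
pose q := lin_desc (coker_proj_surj (f := dout X m)) rs0.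
apply: (A_retract (s := q) (r := coker_proj (dout X m))); last exact: lperp_Psi_vertex.
move=> y; have [x <-] := coker_proj_surj y; rewrite lin_descE /=.
pose c := coker_proj (dout X m) \o eps (vnext m).
have c_kills : kills_in c.
  apply/kills_inP => z; rewrite -[LHS]/(coker_proj (dout X m) (eps _ (dout _ m z))).
  by rewrite mid_map_dout; apply/coker_proj_eq0; exists (mid_map eps m z).
rewrite -[in RHS](sE _ x); apply/esym/(etrans (rE _ c c_kills (s _ x))).
by congr (coker_proj _ _); apply: free_rep_liftE.
Qed.

Lemma Phi_Psi_compatible : compatible (C := repCat R) (Phi A)
  (rperp (C := repCat R) (Phi A)) (lperp (C := repCat R) (Psi B)) (Psi B).
Proof.
split=> [X Y|X]; first exact: Ext1_Phi_Psi.
split=> -[h h'].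
  split; last exact: Phi_rperp_Psi.
  by move=> Y PY; apply: Ext1_Phi_Psi.
split; first exact: Psi_lperp_Phi.
by move=> Y PY; apply: Ext1_Phi_Psi.
Qed.

End CotorsionPairs.

(* The k-algebra R is a unital ring with a ring morphism from k to its centre;
   pzRingType rather than algType k, as the latter excludes the zero algebra. *)
Theorem theoremC (k : fieldType) (R : pzRingType) (iota : {rmorphism k -> R})
    (iota_central : forall (c : k) (x : R), iota c * x = x * iota c)
    (A B : modCat R -> Prop) (hAB : hereditary_cotorsion_pair A B) :
  [/\ hereditary_cotorsion_pair (Phi A) (rperp (Phi A)),
      hereditary_cotorsion_pair (lperp (Psi B)) (Psi B) &
      compatible (Phi A) (rperp (Phi A)) (lperp (Psi B)) (Psi B)].
Proof.
split; [exact: (Phi_pair iota hAB)|exact: (Psi_pair iota hAB)|].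
exact: (Phi_Psi_compatible iota hAB).
Qed.
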